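(* Let $K$ be a number field and $p\geq 2$ a prime number such that the Leopoldt conjecture holds for $p$ in $K$. Let $E_K$ be the group of $p$-principal global units of $K$, let $U_K$ be the $\mathbb{Z}_p$-module of principal local units at the $p$-places, let $\overline{E}_K$ be the topological closure of (the diagonal image of) $E_K$ in $U_K$, and let $\kappa_K$ be the Kummer--Leopoldt constant of $K$ at $p$. Then $p^{\kappa_K}$ is the exponent of the finite group $$\mathrm{tor}_{\mathbb{Z}_p}\big(\log(U_K)/\log(\overline{E}_K)\big),$$ where $\log$ is the $p$-adic logarithm (and $\log(\overline{E}_K)=\mathbb{Z}_p\,\log(E_K)$).
   Context: Let $K$ be a number field and $p\ge 2$ a prime. For each prime ideal $\mathfrak{p}\mid p$ of $K$ let $K_{\mathfrak{p}}$ be the completion and $\overline{\mathfrak{p}}$ the maximal ideal of its ring of integers. - $E_K$ is the group of $p$-principal global units of $K$: units $\varepsilon$ of the ring of integers of $K$ with $\varepsilon\equiv 1 \pmod{\prod_{\mathfrak{p}\mid p}\mathfrak{p}}$. - $U_K := \{u\in \bigoplus_{\mathfrak{p}\mid p}K_{\mathfrak{p}}^\times : u=1+x,\ x\in\bigoplus_{\mathfrak{p}\mid p}\overline{\mathfrak{p}}\}$, the (multiplicatively written) $\mathbb{Z}_p$-module of principal local units at $p$. - $E_K$ is embedded diagonally in $U_K$ (this embedding is understood everywhere), and $\overline{E}_K$ is its topological closure, i.e. the image of $E_K\otimes\mathbb{Z}_p\to U_K$. - $\log:U_K\to\bigoplus_{\mathfrak{p}\mid p}K_{\mathfrak{p}}$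 is defined componentwise by $\log(1+x)=\sum_{i\ge1}(-1)^{i+1}x^i/i$. - The Leopoldt conjecture for $p$ in $K$ is the condition $\mathrm{rk}_{\mathbb{Z}_p}(\overline{E}_K)=\mathrm{rk}_{\mathbb{Z}}(E_K)$. - $\mathrm{tor}_{\mathbb{Z}_p}(M)$ denotes the $\mathbb{Z}_p$-torsion submodule of $M$. - Kummer--Leopoldt constant (under the Leopoldt conjecture for $p$ in $K$): $\kappa_K$ is the smallest integer $c\geq 0$ such that for all sufficiently large $n$, any unit $\varepsilon\in E_K$ such that $\varepsilon\in U_K^{p^{n+c}}$ is necessarily in $E_K^{p^n}$. (Here $U_K^{p^m}$ and $E_K^{p^m}$ denote the groups of $p^m$-th powers.) *)

(* Defs.v *)
From HB Require Import structures.
From mathcomp Require Import all_boot all_order all_algebra all_field.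
From mathcomp Require Import all_classical all_reals all_analysis.

Set Implicit Arguments.
Unset Strict Implicit.
Unset Printing Implicit Defensive.

Import Order.TTheory GRing.Theory Num.Theory numFieldNormedType.Exports.

Local Open Scope classical_set_scope.
Local Open Scope ring_scope.

Section RingOfIntegers.
Context (K : fieldExtType rat).

Definition integer_pred : {pred K} :=
  fun x => `[< integralOver (intr : int -> K) x >].

Fact integer_pred_subring : subring_closed integer_pred.
Proof.
split=> [|x y /asboolP hx /asboolP hy|x y /asboolP hx /asboolP hy];
  apply/asboolP.
- exact: integral1.
- exact: integral_sub.
- exact: integral_mul.
Qed.

HB.instance Definition _ :=
  GRing.isSubringClosed.Build K integer_pred integer_pred_subring.

Record integers := Integers {
  integer_val :> K;
  integer_valP : integer_val \in integer_pred }.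

HB.instance Definition _ := [isSub for integer_val].
HB.instance Definition _ := [Choice of integers by <:].
HB.instance Definition _ := [SubChoice_isSubComNzRing of integers by <:].

Definition integer_unit : set integers := [set x | exists y, x * y = 1].

(* finite sums of products *)
Definition idealM (I J : set integers) : set integers :=
  [set x | exists n (a b : 'I_n -> integers),
     [/\ forall i, I (a i), forall i, J (b i) & x = \sum_i a i * b i]].

Definition idealX (I : set integers) (n : nat) : set integers :=
  iter n (idealM I) setT.

(* [idealr_closed] contains the properness of the ideal *)
Definition prime_ideal (P : set integers) : Prop :=
  idealr_closed [in P] /\ prime_idealr_closed [in P].

Definition primes_above (p : nat) : set (set integers) :=
  [set P | prime_ideal P /\ P p%:R].

(* The product is over a finite set: only finitely many primes contain p. *)
Definition principal_units (p : nat) : set K :=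
  [set integer_val e | e in [set e | integer_unit e /\
    (\big[idealM/setT]_(P \in primes_above p) P) (e - 1)]].

End RingOfIntegers.

Arguments primes_above K p : clear implicits.
Arguments principal_units K p : clear implicits.

(* The norm of [normedZmodType] satisfies `|x *+ n| = `|x| *+ n, which is
   incompatible with the ultrametric inequality in characteristic 0; the norm
   of a valued field is therefore a separate notion. *)
Record valuedField (R : realType) := ValuedField {
  vfield : fieldType;
  vfield_norm : vfield -> R;
  vfield_norm_ge0 : forall x, 0 <= vfield_norm x;
  vfield_norm_eq0 : forall x, vfield_norm x = 0 <-> x = 0;
  vfield_normM : forall x y, vfield_norm (x * y) = vfield_norm x * vfield_norm y;
  vfield_normD : forall x y,
    vfield_norm (x + y) <= Num.max (vfield_norm x) (vfield_norm y) }.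

Definition valued (R : realType) (L : valuedField R) : Type := vfield L.
Coercion valued : valuedField >-> Sortclass.

Definition vnorm (R : realType) (L : valuedField R) (x : L) : R :=
  vfield_norm x.

Section ValuedField.
Context (R : realType) (L : valuedField R).

HB.instance Definition _ := GRing.Field.on (valued L).
HB.instance Definition _ := isPointed.Build (valued L) 0.

Let dist (x y : L) : R := vnorm (x - y).

Let distxx x : dist x x = 0.
Proof. by rewrite /dist subrr; apply/vfield_norm_eq0. Qed.

Let dist_positivity x y : dist x y = 0 -> x = y.
Proof. by move/vfield_norm_eq0/eqP; rewrite subr_eq0 => /eqP. Qed.

Let dist_sym x y : dist x y = dist y x.
Proof.
rewrite /dist -opprB -mulN1r /vnorm vfield_normM.
suff -> : vfield_norm (-1 : vfield L) = 1 by rewrite mul1r.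
have v1 : vfield_norm (1 : vfield L) != 0.
  by apply/eqP => /vfield_norm_eq0/eqP; rewrite oner_eq0.
apply/eqP; rewrite -(eqrXn2 (n := 2)) ?vfield_norm_ge0// expr1n expr2.
rewrite -vfield_normM mulrNN mulr1; apply/eqP/(mulfI v1).
by rewrite -vfield_normM !mulr1.
Qed.

Let dist_triangle y x z : dist x z <= dist x y + dist y z.
Proof.
rewrite /dist -(subrKA y); apply: le_trans (vfield_normD _ _) _.
by rewrite ge_max lerDl lerDr !vfield_norm_ge0.
Qed.

HB.instance Definition _ := @isMetric.Build R (valued L) dist
  distxx dist_positivity dist_sym dist_triangle.

End ValuedField.

(* A completion of K at P, determined up to unique isomorphism of topological
   fields over K. The last field says that the norm restricts on K to
   c ^ (v_P x), with v_P the P-adic valuation: for x integral, v_P x is the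
   largest n such that x lies in P ^ n. *)
Record adicCompletion (R : realType) (K : fieldExtType rat)
    (P : set (integers K)) := AdicCompletion {
  completion_field :> valuedField R;
  completion_complete : forall F : set_system completion_field,
    ProperFilter F -> cauchy F -> cvg F;
  completion_map : {rmorphism K -> completion_field};
  completion_dense : dense (range completion_map);
  completion_adic : exists2 c : R, 0 < c < 1 &
    forall (x : integers K) (n : nat),
      idealX P n x <-> vnorm (completion_map (integer_val x)) <= c ^+ n }.

(* Z_p as the inverse limit of the Z / p ^ n, with canonical representatives *)
Record padicInt (p : nat) := PadicInt {
  residue :> nat -> nat;
  residue_lt : forall n, (residue n < p ^ n)%N;
  residue_coherent : forall n, residue n.+1 = residue n %[mod p ^ n] }.

Definition padic_eq0 (p : nat) (a : padicInt p) : Prop := forall n, a n = 0%N.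

Definition powers (S : pzSemiRingType) (A : set S) (m : nat) : set S :=
  [set x ^+ m | x in A].

(* r is the rank of a set with respect to a notion of independent family *)
Definition is_rank (T : Type) (indep : forall r, ('I_r -> T) -> Prop)
    (A : set T) (r : nat) : Prop :=
  (exists2 u : 'I_r -> T, (forall i, A (u i)) & indep r u) /\
  (forall s (u : 'I_s -> T), (forall i, A (u i)) -> indep s u -> (s <= r)%N).

Definition Z_indep (F : fieldType) (r : nat) (e : 'I_r -> F) : Prop :=
  forall a : 'I_r -> int, \prod_i e i ^ a i = 1 -> forall i, a i = 0.

Definition coset (V : zmodType) (B : set V) (x : V) : set V :=
  [set x + b | b in B].

(* log x = \sum_(i >= 1) (-1) ^ (i + 1) (x - 1) ^ i / i *)
Definition padic_log (R : realType) (L : valuedField R) (x : L) : L :=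
  lim ((\sum_(1 <= i < n) (-1) ^+ i.+1 * (x - 1) ^+ i / i%:R) @[n --> \oo]).

Definition maximal_ideal (R : realType) (L : valuedField R) : set L :=
  [set x | vnorm x < 1].

Section LocalSum.
Context (R : realType) (K : fieldExtType rat) (p : nat).
Context (Kp : forall P : primes_above K p, adicCompletion R (val P)).

(* The index set is finite, so that the direct sum is the full product. *)
Definition local_sum := prod_topology (fun P => Kp P).

HB.instance Definition _ := Topological.on local_sum.
HB.instance Definition _ := Choice.on local_sum.

Implicit Types (x y z u : local_sum).

Let add x y : local_sum := fun P => x P + y P.
Let opp x : local_sum := fun P => - x P.
Let mul x y : local_sum := fun P => x P * y P.
Let zero : local_sum := fun=> 0.
Let one : local_sum := fun=> 1.

Let addA : associative add.
Proof. by move=> x y z; apply: functional_extensionality_dep => P; exact: addrA. Qed.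
Let addC : commutative add.
Proof. by move=> x y; apply: functional_extensionality_dep => P; exact: addrC. Qed.
Let add0 : left_id zero add.
Proof. by move=> x; apply: functional_extensionality_dep => P; exact: add0r. Qed.
Let addN : left_inverse zero opp add.
Proof. by move=> x; apply: functional_extensionality_dep => P; exact: addNr. Qed.
Let mulA : associative mul.
Proof. by move=> x y z; apply: functional_extensionality_dep => P; exact: mulrA. Qed.
Let mulC : commutative mul.
Proof. by move=> x y; apply: functional_extensionality_dep => P; exact: mulrC. Qed.
Let mul1 : left_id one mul.
Proof. by move=> x; apply: functional_extensionality_dep => P; exact: mul1r. Qed.
Let mulD : left_distributive mul add.
Proof. by move=> x y z; apply: functional_extensionality_dep => P; exact: mulrDl. Qed.

HB.instance Definition _ := GRing.isZmodule.Build local_sum addA addC add0 addN.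
HB.instance Definition _ :=
  GRing.Zmodule_isComPzRing.Build local_sum mulA mulC mul1 mulD.

Definition diag (e : K) : local_sum := fun P => completion_map (Kp P) e.

Definition local_units : set local_sum :=
  [set u : local_sum | (forall P, u P != 0) /\
    exists2 x : local_sum, (forall P, maximal_ideal (x P)) & u = 1 + x].

Definition unit_closure : set local_sum :=
  local_units `&` closure (diag @` principal_units K p).

Definition local_log u : local_sum := fun P => padic_log (u P).

(* A p-adic integer acts as the limit of the actions of its residues. *)
Definition Zp_exp u (a : padicInt p) : local_sum :=
  fun P => lim (u P ^+ a n @[n --> \oo]).

Definition Zp_scale (a : padicInt p) x : local_sum :=
  fun P => lim (x P *+ a n @[n --> \oo]).

Definition Zp_indep (r : nat) (u : 'I_r -> local_sum) : Prop :=
  forall a : 'I_r -> padicInt p,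
    \prod_i Zp_exp (u i) (a i) = 1 -> forall i, padic_eq0 (a i).

Definition leopoldt : Prop :=
  exists2 r, is_rank Zp_indep unit_closure r &
             is_rank (@Z_indep K) (principal_units K p) r.

Definition Zp_span (A : set local_sum) : set local_sum :=
  [set x : local_sum | exists m (a : 'I_m -> padicInt p) (y : 'I_m -> local_sum),
     (forall i, A (y i)) /\ x = \sum_i Zp_scale (a i) (y i)].

Definition kummer_leopoldt_bound (c : nat) : Prop :=
  exists N, forall n, (N <= n)%N -> forall e, principal_units K p e ->
    powers local_units (p ^ (n + c)) (diag e) ->
    powers (principal_units K p) (p ^ n) e.

Definition is_kummer_leopoldt_constant (c : nat) : Prop :=
  kummer_leopoldt_bound c /\
  forall c', kummer_leopoldt_bound c' -> (c <= c')%N.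

(* The elements of A whose class in A / B is Z_p-torsion *)
Definition torsion_mod (A B : set local_sum) : set local_sum :=
  [set x : local_sum | A x /\ exists2 a : padicInt p, ~ padic_eq0 a & B (Zp_scale a x)].

(* The torsion of A / B, as a set of cosets of B *)
Definition quotient_torsion (A B : set local_sum) : set (set local_sum) :=
  coset B @` torsion_mod A B.

(* N is the exponent of the torsion of A / B; N (x + B) = 0 in A / B is
   expressed as N x \in B *)
Definition is_torsion_exponent (A B : set local_sum) (N : nat) : Prop :=
  let kills M := forall x, torsion_mod A B x -> B (x *+ M) in
  [/\ (0 < N)%N, kills N & forall M, (0 < M)%N -> kills M -> (N <= M)%N].

End LocalSum.

Arguments diag {R K p} Kp e.
Arguments local_units {R K p} Kp.
Arguments unit_closure {R K p} Kp.
Arguments local_log {R K p} Kp u.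

(* Main.v *)
(* Write V for the product of the completions above p, L for the image of E_K
   under log in V and Lambda for its closure.  No finiteness of the unit group
   is used.  As L is torsion-free and has Z-rank at most r, it is generated modulo pL
   by some l_1, ..., l_t with t <= r, so Lambda is the Z_p-span of the l_i and
   equals log of the closure of E_K.  By the Leopoldt hypothesis Lambda
   contains r elements independent over Z_p, which forces the l_i to be
   independent as well; quantitatively, there is d such that an integral
   combination of the l_i lying in p^d times a fixed lattice containing log U_K
   has all its coefficients divisible by p.  Hence L meets p^n Lambda in p^n L,
   and the torsion of log U_K / Lambda is finite and killed by p^d.
   The kernel of log on U_K is killed by a fixed power of p.
   - If p^c kills the torsion and e = u^(p^(n+c)), then p^c log u is in Lambda,
     so log e is in L and in p^n Lambda, hence log e = p^n log f; for large n
     the power p^n kills the remaining root of unity and e = f^(p^n).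
   - If c is a Kummer-Leopoldt bound and p^k log u is in Lambda, approximate
     p^(n+c) log u by log e modulo p^(n+c) Lambda; up to roots of unity e is a
     p^(n+c)-th power in U_K, so log e is in p^n L and p^c log u is in Lambda. *)
From HB Require Import structures.
Require Import Defs.
From mathcomp Require Import all_boot all_order all_algebra all_field.
From mathcomp Require Import all_classical all_reals all_analysis.
From mathcomp Require Import ring zify.

Set Implicit Arguments.
Unset Strict Implicit.
Unset Printing Implicit Defensive.

Import Order.TTheory GRing.Theory Num.Theory numFieldNormedType.Exports.

Local Open Scope classical_set_scope.
Local Open Scope ring_scope.

(** * Integral relations and p-adic integers *)

Lemma rat_common_denominator (s : nat) (v : 'I_s -> rat) :
  exists (D : int) (c : 'I_s -> int), D != 0 /\ forall i, v i * D%:~R = (c i)%:~R.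
Proof.
exists (\prod_i denq (v i)).
exists (fun i => numq (v i) * \prod_(j | j != i) denq (v j)); split.
  by apply/prodf_neq0 => i _; exact: denq_neq0.
move=> i; rewrite (bigD1 i)//= 2!rmorphM/= mulrA; congr (_ * _).
by rewrite numqE.
Qed.

Lemma rat_vectors_relation (s t : nat) (A : 'M[rat]_(s, t)) : (t < s)%N ->
  exists2 c : 'I_s -> int, (exists i, c i != 0) &
    forall j, \sum_i (c i)%:~R * A i j = 0.
Proof.
move=> ts.
have : kermx A != 0.
  rewrite kermx_eq0 /row_free neq_ltn.
  by rewrite (leq_ltn_trans (rank_leq_col A) ts).
case/rowV0Pn => v /sub_kermxP vA v0.
have [D [c [D0 cE]]] := rat_common_denominator (fun i => v 0 i).
exists c => [|j].
  case/rV0Pn: v0 => i vi0; exists i.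
  by rewrite -(intr_eq0 rat) -cE mulf_neq0 // intr_eq0.
have := congr1 (fun B : 'rV[rat]_t => B 0 j * D%:~R) vA; rewrite !mxE mul0r mulr_suml => vE.
rewrite -[RHS]vE; apply: eq_bigr => i _.
by rewrite -cE mulrAC.
Qed.

(** As long as p divides all entries it is divided out; this stops because the absolute value of the
    nonzero entry [c i0] decreases each time. *)
Lemma primitive_part (p s : nat) (c : 'I_s -> int) : prime p ->
  (exists i, c i != 0) ->
  exists (k : nat) (d : 'I_s -> int), (forall i, c i = d i * (p ^ k)%:Z) /\
    exists i, ~~ (p %| d i)%Z.
Proof.
move=> pp [i0]; have [n] := ubnP `|c i0|%N.
elim: n => // n IH in c *; rewrite ltnS => cn c0.
have [/forallP pc|/forallPn pc] := boolP [forall i, (p %| c i)%Z]; last first.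
  by exists 0%N, c; split=> // i; rewrite expn0 mulr1.
have cE i : c i = (c i %/ p)%Z * p%:Z by rewrite divzK.
have [||k [d [dE pd]]] := IH (fun i => (c i %/ p)%Z).
- move: cn c0; rewrite {1 2}(cE i0) abszM mulf_eq0 negb_or absz_nat.
  move=> qn /andP[q0 _]; apply: leq_trans qn.
  by rewrite ltn_Pmulr ?prime_gt1// absz_gt0.
- by move: c0; rewrite {1}(cE i0) mulf_eq0 negb_or => /andP[].
exists k.+1, d; split=> // i.
by rewrite (cE i) dE expnS mulnC PoszM mulrA.
Qed.

Lemma int_vectors_primitive_relation (p s t : nat) (A : 'I_s -> 'I_t -> int) :
  prime p -> (t < s)%N ->
  exists2 c : 'I_s -> int, (exists i, ~~ (p %| c i)%Z) &
    forall j, \sum_i c i * A i j = 0.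
Proof.
move=> pp /rat_vectors_relation-/(_ (\matrix_(i, j) (A i j)%:~R))[c c0 cA].
have [k [d [cd pd]]] := primitive_part pp c0; exists d => // j.
apply/eqP; rewrite -(intr_eq0 rat) -[_ == _]orFb.
have pk : (p ^ k)%:Z%:~R == 0 :> rat = false.
  by apply/negbTE; rewrite intr_eq0 eqz_nat -lt0n expn_gt0 prime_gt0.
rewrite -{}pk -mulf_eq0 -rmorphM mulr_sumr; apply/eqP.
rewrite -[RHS](cA j) rmorph_sum/=; apply: eq_bigr => i _.
by rewrite !mxE -rmorphM cd mulrCA mulrA.
Qed.

Lemma padic_of_digits (p : nat) (d : nat -> nat) : (forall k, d k < p)%N ->
  exists a : padicInt p, forall n, a n = (\sum_(k < n) d k * p ^ k)%N.
Proof.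
move=> dp.
have dlt n : (\sum_(k < n) d k * p ^ k < p ^ n)%N.
  elim: n => [|n IH]; first by rewrite big_ord0.
  rewrite big_ord_recr/= expnS -addSn; apply: leq_trans (leq_add IH (leqnn _)) _.
  by rewrite -mulSn leq_mul2r dp orbT.
have dco n : (\sum_(k < n.+1) d k * p ^ k = \sum_(k < n) d k * p ^ k %[mod p ^ n])%N.
  by rewrite big_ord_recr/= addnC modnMDl.
by exists (PadicInt dlt dco).
Qed.

Lemma padic_residue_mod (p : nat) (a : padicInt p) (m n : nat) : (m <= n)%N ->
  a n = a m %[mod p ^ m].
Proof.
elim: n => [|n IH]; first by rewrite leqn0 => /eqP->.
rewrite leq_eqVlt => /predU1P[->//|]; rewrite ltnS => mn.
rewrite -(IH mn) -(modn_dvdm (a n.+1) (dvdn_exp2l p mn)) residue_coherent.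
by rewrite modn_dvdm ?dvdn_exp2l.
Qed.

(* Koenig's lemma on the tree of digit vectors. *)
Lemma padic_compactness (p r : nat) (T : nat -> ('I_r -> int) -> Prop) :
  (0 < p)%N -> (forall n c, T n.+1 c -> T n c) -> (forall n, exists c, T n c) ->
  exists g : 'I_r -> padicInt p, forall n, exists2 c, T n c &
    forall i, ((p ^ n)%:Z %| c i - (g i n)%:Z)%Z.
Proof.
move=> p0 TS T0.
have Tle m n c : (m <= n)%N -> T n c -> T m c.
  by move=> /subnKC <-; elim: (n - m)%N => [|k IH]; rewrite ?addn0 ?addnS// => /TS.
(* [G m v] means that the node v at level m has descendants at every depth. *)
pose G m (v : 'I_r -> nat) := forall n, exists2 c, T n c &
  forall i, ((p ^ m)%:Z %| c i - (v i)%:Z)%Z.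
pose next m v (d : {ffun 'I_r -> 'I_p}) i := (v i + d i * p ^ m)%N.
have step (mv : nat * ('I_r -> nat)) : exists d, G mv.1 mv.2 -> G mv.1.+1 (next mv.1 mv.2 d).
  case: mv => m v /=; apply: contrapT => /forallNP nd.
  have Gmv : G m v by apply: contrapT => nG; apply: (nd [ffun=> Ordinal p0]).
  (* If each of the finitely many children d of v died at some depth [N d], a vector below v at the
     maximal depth would have no admissible next digit. *)
  have /choice[N NP] (d : {ffun 'I_r -> 'I_p}) : exists n, ~ exists2 c, T n c &
      forall i, ((p ^ m.+1)%:Z %| c i - (next m v d i)%:Z)%Z.
    by apply/existsNP => GS; apply: (nd d).
  have [c Tc cv] := Gmv (\max_d N d).
  have q_lt i : (`|modz (divz (c i - (v i)%:Z) (p ^ m)%:Z) p%:Z| < p)%N.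
    by rewrite -ltz_nat gez0_abs ?modz_ge0 ?ltz_pmod// lt0r_neq0.
  pose d := [ffun i => Ordinal (q_lt i)].
  apply: (NP d); exists c; first exact: Tle (leq_bigmax d) Tc.
  move=> i; rewrite /next ffunE /= PoszD PoszM opprD addrA.
  rewrite gez0_abs ?modz_ge0 ?lt0r_neq0//.
  rewrite -{1}(divzK (cv i)) -mulrBl expnS PoszM dvdz_mul//.
  by rewrite {1}(divz_eq (divz (c i - (v i)%:Z) (p ^ m)%:Z) p%:Z) addrK dvdz_mull.
have /choice[h hP] := step.
pose v := fix v m := if m is m'.+1 then next m' (v m') (h (m', v m')) else fun=> 0%N.
have Gv m : G m (v m).
  elim: m => [n|m IH]; last exact: hP.
  by have [c Tc] := T0 n; exists c => // i; rewrite expn0 dvd1z.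
have /choice[g gP] (i : 'I_r) : exists a : padicInt p, forall n, a n = v n i.
  have [a aP] := @padic_of_digits p (fun k => h (k, v k) i) (fun k => ltn_ord _).
  exists a => n; rewrite aP; elim: n => [|n IH]; first by rewrite big_ord0.
  by rewrite big_ord_recr/= IH.
exists g => n; have [c Tc cv] := Gv n n; exists c => // i.
by rewrite gP.
Qed.

(** * Lattices in p-adically topologized groups *)

Definition subgroup (V : zmodType) (A : set V) :=
  A 0 /\ forall x y, A x -> A y -> A (x - y).

Section Subgroup.
Context (V : zmodType) (A : set V).
Hypothesis subA : subgroup A.

Lemma subgroup0 : A 0. Proof. by case: subA. Qed.

Lemma subgroupB x y : A x -> A y -> A (x - y).
Proof. by case: subA => _; apply. Qed.

Lemma subgroupN x : A x -> A (- x).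
Proof. by move=> Ax; rewrite -sub0r; apply: subgroupB => //; exact: subgroup0. Qed.

Lemma subgroupD x y : A x -> A y -> A (x + y).
Proof. by move=> Ax Ay; rewrite -[y]opprK; apply: subgroupB => //; exact: subgroupN. Qed.

Lemma subgroupMn x n : A x -> A (x *+ n).
Proof.
by move=> Ax; elim: n => [|n IH]; [exact: subgroup0|rewrite mulrS; exact: subgroupD].
Qed.

Lemma subgroupMz x c : A x -> A (x *~ c).
Proof. by move=> Ax; case: c => n; rewrite ?NegzE ?mulrNz; [|apply: subgroupN]; exact: subgroupMn. Qed.

Lemma subgroup_sum n (x : 'I_n -> V) : (forall i, A (x i)) -> A (\sum_i x i).
Proof.
by move=> Ax; apply: big_ind => //; [exact: subgroup0|exact: subgroupD].
Qed.

Lemma subgroup_comb n (x : 'I_n -> V) (c : 'I_n -> int) :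
  (forall i, A (x i)) -> A (\sum_i x i *~ c i).
Proof. by move=> Ax; apply: subgroup_sum => i; exact: subgroupMz. Qed.

End Subgroup.

(** * Generators modulo p of a torsion-free group *)

Section TorsionFree.
Context (V : zmodType) (p : nat).
Hypothesis pp : prime p.
Hypothesis tf : forall x : V, x *+ p = 0 -> x = 0.

Lemma mulrnX_inj k : injective (fun x : V => x *+ p ^ k).
Proof.
move=> x y /eqP; rewrite -subr_eq0 -mulrnBl => /eqP xy.
apply/eqP; rewrite -subr_eq0; apply/eqP; move: xy.
elim: k => [|k IH]; first by rewrite expn0 mulr1n.
by rewrite expnSr mulrnA => /tf/IH.
Qed.

Lemma comb_mulrn n (x : 'I_n -> V) (c : 'I_n -> int) m :
  \sum_i x i *~ (c i * m%:Z) = (\sum_i x i *~ c i) *+ m.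
Proof. by rewrite -sumrMnl; apply: eq_bigr => i _; rewrite mulrzA -pmulrn. Qed.

(** The l_i form a maximal family independent modulo [p L]. Such a family is independent over Z,
    since a relation can be divided by the p-part of its content, so its size is at most r. By
    maximality x enters a relation modulo [p L], and Bezout solves it for x. *)
Lemma mod_p_basis (L : set V) (r : nat) : subgroup L ->
  (forall s (x : 'I_s -> V), (forall i, L (x i)) ->
    (forall c, \sum_i x i *~ c i = 0 -> forall i, c i = 0) -> (s <= r)%N) ->
  exists t (l : 'I_t -> V), [/\ (t <= r)%N, forall i, L (l i) &
    forall x, L x -> exists c, exists2 y, L y & x = \sum_i l i *~ c i + y *+ p].
Proof.
move=> subL Lr.
pose indep t (l : 'I_t -> V) := (forall i, L (l i)) /\
  forall c y, L y -> \sum_i l i *~ c i = y *+ p -> forall i, (p %| c i)%Z.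
have indep_le t (l : 'I_t -> V) : indep t l -> (t <= r)%N.
  move=> [Ll lp]; apply: Lr Ll _ => c cl i0; apply/eqP; apply: contrapT => /negP ci0.
  have [k [d [cd [i]]]] := primitive_part pp (ex_intro _ i0 ci0).
  case/negP; apply: lp (subgroup0 subL) _ i.
  rewrite mul0rn; apply: (@mulrnX_inj k); rewrite -comb_mulrn mul0rn -[RHS]cl.
  by apply: eq_bigr => i _; rewrite cd.
pose P t := `[<exists l : 'I_t -> V, indep t l>].
have P0 : exists t, P t.
  exists 0%N; apply/asboolP; exists (fun=> 0); split=> [i|c y _ _ i]; by case: i.
have Pr t : P t -> (t <= r)%N by move=> /asboolP[l /indep_le].
case: (ex_maxnP P0 Pr) => t /asboolP[l lt] tmax.
have [Ll lp] := lt; exists t, l; split=> [|//|x Lx]; first exact: indep_le lt.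
pose l' (i : 'I_t.+1) := oapp l x (unlift ord0 i).
have : ~ indep t.+1 l'.
  move=> l'_indep; have /tmax : P t.+1 by apply/asboolP; exists l'.
  by rewrite ltnn.
have Ll' i : L (l' i) by rewrite /l'; case: unlift.
have l'E c : \sum_i l' i *~ c i = x *~ c ord0 + \sum_i l i *~ c (lift ord0 i).
  rewrite big_ord_recl /l' unlift_none; congr (_ + _).
  by apply: eq_bigr => i _; rewrite liftK.
move=> /not_andP[//|/existsNP[c /existsNP[y /not_implyP[Ly /not_implyP[]]]]].
rewrite l'E => cy /existsNP[i0 /negP ci0].
(* Otherwise the term in x could be absorbed into [p L], leaving a forbidden relation among the l_i
   alone. *)
have pc : ~~ (p %| c ord0)%Z.
  apply/negP => /dvdzP[q qE].
  case: (unliftP ord0 i0) ci0 => [i ->|->]; last by rewrite qE dvdz_mull.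
  case/negP; apply: (lp (fun i => c (lift ord0 i)) (y - x *~ q)).
    by apply: subgroupB => //; exact: subgroupMz.
  rewrite mulrnBl -cy qE mulrzA -pmulrn addrC addKr //.
have cop : gcdz (c ord0) p = 1.
  by apply/eqP; rewrite -/(coprimez _ _) coprimez_sym coprimezE /= prime_coprime.
have [u [w]] := Bezoutz (c ord0) p; rewrite cop => uw.
exists (fun i => - (u * c (lift ord0 i))), (y *~ u + x *~ w).
  by apply: subgroupD => //; exact: subgroupMz.
have -> : \sum_i l i *~ - (u * c (lift ord0 i)) = - ((y *+ p - x *~ c ord0) *~ u).
  rewrite -cy addrC addKr mulrz_suml -sumrN; apply: eq_bigr => i _.
  by rewrite mulrNz mulrC mulrzA.
rewrite mulrzBl opprB !pmulrn mulrzDl -!mulrzA addrA [p%:Z * u]mulrC subrK.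
by rewrite [c ord0 * u]mulrC -mulrzDr uw.
Qed.

End TorsionFree.

(** * The p-adic topology defined by a subgroup *)

Section AdicTopology.
Context (V : zmodType) (p : nat) (B : set V).
Hypothesis pp : prime p.
Hypothesis tf : forall x : V, x *+ p = 0 -> x = 0.
Hypothesis subB : subgroup B.

(** The subgroups p^k B serve as basic neighbourhoods of 0. *)
Definition pmul (k : nat) : set V := [set b *+ p ^ k | b in B].

Definition adic_closure (A : set V) : set V :=
  [set x | forall k, exists2 a, A a & pmul k (x - a)].

Lemma subgroup_pmul k : subgroup (pmul k).
Proof.
split; first by exists 0; [exact: subgroup0|rewrite mul0rn].
move=> _ _ [b Bb <-] [b' Bb' <-]; exists (b - b'); first exact: subgroupB.
by rewrite mulrnBl.
Qed.

Lemma pmul_le j k : (j <= k)%N -> pmul k `<=` pmul j.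
Proof.
move=> jk _ [b Bb <-]; exists (b *+ p ^ (k - j)); first exact: subgroupMn.
by rewrite -mulrnA -expnD subnK.
Qed.

Lemma pmul_mulrnK j k x : pmul (k + j) (x *+ p ^ j) -> pmul k x.
Proof.
move=> [b Bb]; rewrite expnD mulrnA => /(mulrnX_inj tf) <-.
by exists b.
Qed.

Lemma pmul_dvd k x c : ((p ^ k)%:Z %| c)%Z -> B x -> pmul k (x *~ c).
Proof.
move=> /dvdzP[q ->] Bx; exists (x *~ q); first exact: subgroupMz.
by rewrite mulrzA pmulrn.
Qed.

Lemma sub_adic_closure A : A `<=` adic_closure A.
Proof. by move=> x Ax k; exists x => //; rewrite subrr; exact: subgroup0 (subgroup_pmul k). Qed.

Lemma adic_closure_closed A x :
  (forall k, exists2 a, adic_closure A a & pmul k (x - a)) -> adic_closure A x.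
Proof.
move=> xA k; have [a aA xa] := xA k; have [a' Aa' aa'] := aA k.
exists a' => //; rewrite -(subrK a x) -addrA.
exact: (subgroupD (subgroup_pmul k)).
Qed.

Lemma subgroup_adic_closure A : subgroup A -> subgroup (adic_closure A).
Proof.
move=> subA; split; first by apply: sub_adic_closure; exact: subgroup0.
move=> x y xA yA k; have [a Aa xa] := xA k; have [b Ab yb] := yA k.
exists (a - b); first exact: subgroupB.
by rewrite opprD addrACA -opprD; exact: (subgroupB (subgroup_pmul k)).
Qed.

Lemma adic_closure_subset A : A `<=` B -> adic_closure A `<=` B.
Proof.
move=> AB x /(_ 0%N)[a /AB Ba [b Bb]]; rewrite expn0 mulr1n => xa.
by rewrite -(subrK a x) -xa; exact: subgroupD.
Qed.

(* A quantitative form of Z_p-independence, which involves no p-adic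
   coefficient. *)
Definition adic_indep (r : nat) (x : 'I_r -> V) (d : nat) :=
  forall c : 'I_r -> int, pmul d (\sum_i x i *~ c i) -> forall i, (p %| c i)%Z.

(** Each use of independence extracts one factor p from all coefficients; torsion-freeness allows
    the membership in p^(d+k+1) B to be divided by p before the next use. *)
Lemma adic_indep_dvd r (x : 'I_r -> V) d : adic_indep x d -> forall k c,
  pmul (d + k) (\sum_i x i *~ c i) -> forall i, ((p ^ k)%:Z %| c i)%Z.
Proof.
move=> xd; elim=> [|k IH] c cx i; first by rewrite expn0 dvd1z.
have pc : forall i, (p %| c i)%Z by apply: xd; apply: pmul_le cx; exact: leq_addr.
have cE j : c j = divz (c j) p * p%:Z by rewrite divzK.
rewrite (cE i) expnSr PoszM dvdz_mul//; apply: (IH (fun i => divz (c i) p)).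
apply: (@pmul_mulrnK 1); rewrite addn1 -addnS expn1 -comb_mulrn.
by under eq_bigr do rewrite -cE.
Qed.

Lemma iterate_generators t (l : 'I_t -> V) (A : set V) :
  (forall x, A x -> exists c, exists2 y, A y & x = \sum_i l i *~ c i + y *+ p) ->
  forall k x, A x ->
    exists c, exists2 y, A y & x = \sum_i l i *~ c i + y *+ p ^ k.
Proof.
move=> lA k x Ax; elim: k => [|k [c [y Ay ->]]].
  exists (fun=> 0), x; rewrite // expn0 mulr1n big1 ?add0r// => i _.
have [c' [y' Ay' ->]] := lA _ Ay; exists (fun i => c i + c' i * (p ^ k)%:Z), y' => //.
rewrite mulrnDl -mulrnA -expnS addrA -comb_mulrn -big_split/=.
by congr (_ + _); apply: eq_bigr => i _; rewrite mulrzDr.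
Qed.

Section Lattice.
Context (L : set V).
Hypothesis subL : subgroup L.
Hypothesis LB : L `<=` B.
Context (t : nat) (l : 'I_t -> V).
Hypothesis Ll : forall i, L (l i).
Hypothesis lL : forall x, L x ->
  exists c, exists2 y, L y & x = \sum_i l i *~ c i + y *+ p.

(* Pigeonhole on the finitely many digit vectors: closure commutes with finite
   unions. *)
Lemma closure_digits x : adic_closure L x ->
  exists (d : {ffun 'I_t -> 'I_p}), exists2 y, adic_closure L y &
    x = \sum_i l i *+ d i + y *+ p.
Proof.
move=> xL.
have [d dP] : exists d : {ffun 'I_t -> 'I_p}, forall m,
    exists2 y, L y & pmul m.+1 (x - \sum_i l i *+ d i - y *+ p).
  apply: contrapT => /forallNP nd.
  have /choice[N NP] d := (existsNP _).2 (nd d).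
  have [a La xa] := xL (\max_d N d).+1.
  have [c [y Ly aE]] := lL La.
  have c_lt i : (`|modz (c i) p%:Z| < p)%N.
    by rewrite -ltz_nat gez0_abs ?modz_ge0 ?ltz_pmod ?lt0r_neq0// ltz_nat prime_gt0.
  pose d := [ffun i => Ordinal (c_lt i)].
  apply: (NP d); exists (y + \sum_i l i *~ divz (c i) p).
    by apply: subgroupD => //; exact: subgroup_comb.
  apply: (@pmul_le _ (\max_d N d).+1); first by rewrite ltnS; exact: leq_bigmax.
  congr pmul: xa; rewrite -addrA -opprD aE; congr (_ - _).
  rewrite mulrnDl addrCA [LHS]addrC; congr (_ + _).
  rewrite -comb_mulrn -big_split/=; apply: eq_bigr => i _.
  rewrite ffunE /= pmulrn gez0_abs ?modz_ge0 ?lt0r_neq0 ?ltz_nat ?prime_gt0//.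
  by rewrite -mulrzDr addrC -divz_eq.
(* Level 0 yields the quotient [y0 + b0], so far only an element of V; after division by p, level m
   approximates it by an element of [L] up to p^m B. *)
have [y0 Ly0 [b0 Bb0 y0E]] := dP 0%N; rewrite expn1 in y0E.
have xE : x = \sum_i l i *+ d i + (y0 + b0) *+ p.
  by rewrite mulrnDl y0E [y0 *+ p + _]addrC subrK addrC subrK.
exists d, (y0 + b0) => // m.
have [y Ly xy] := dP m; exists y => //; apply: (@pmul_mulrnK 1); rewrite expn1 addn1.
by move: xy; rewrite {1}xE [X in X - \sum_i _]addrC addrK mulrnBl.
Qed.

Lemma closure_generators k x : adic_closure L x ->
  exists c, exists2 y, adic_closure L y & x = \sum_i l i *~ c i + y *+ p ^ k.
Proof.
apply: iterate_generators => {}x /closure_digits[d dP].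
by exists (fun i => (d i)%:Z).
Qed.

Lemma closure_lattice_generators k x : adic_closure L x ->
  exists a b, [/\ L a, adic_closure L b & x = a + b *+ p ^ k].
Proof.
move=> /(closure_generators k)[c [y Ly ->]].
by exists (\sum_i l i *~ c i), y; split=> //; exact: subgroup_comb.
Qed.

(* If the combination of the l_i with coefficients b lies in p ^ d B, take a
   relation, nonzero modulo p, between b and the coordinate vectors of the x_j
   modulo p ^ d: these are r + 1 > t vectors of Z^t. *)
Lemma adic_indep_transfer r (x : 'I_r -> V) d : (t <= r)%N ->
  (forall j, adic_closure L (x j)) -> adic_indep x d -> adic_indep l d.
Proof.
move=> tr Lx xd b bd.
have tr' : (t < r.+1)%N by [].
have /choice[A AP] j := closure_generators d (Lx j).
pose A' (j : 'I_r.+1) := oapp A b (unlift ord0 j).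
have [c [j0 pcj0] cA] := int_vectors_primitive_relation A' pp tr'.
have A0 : A' ord0 = b by rewrite /A' unlift_none.
have Al j : A' (lift ord0 j) = A j by rewrite /A' liftK.
have cAE i : c ord0 * b i + \sum_j c (lift ord0 j) * A j i = 0.
  by rewrite -[RHS](cA i) big_ord_recl A0; under [in RHS]eq_bigr do rewrite Al.
(* By the relation, the combination of the x_j with these coefficients equals a multiple of the
   combination of the l_i with coefficients b, up to the errors of the coordinate vectors, and both
   lie in p^d B. *)
have pc j : (p %| c (lift ord0 j))%Z.
  apply: (xd (fun j => c (lift ord0 j))).
  have -> : \sum_j x j *~ c (lift ord0 j) = - ((\sum_i l i *~ b i) *~ c ord0) +
      \sum_j (x j - \sum_i l i *~ A j i) *~ c (lift ord0 j).
    under [X in _ + X]eq_bigr do rewrite mulrzBl.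
    rewrite sumrB addrCA -{1}[LHS]addr0; congr (_ + _); apply/esym/eqP.
    rewrite -opprD oppr_eq0 mulrz_suml; under [X in _ + X]eq_bigr do rewrite mulrz_suml.
    rewrite exchange_big -big_split/=; apply/eqP/big1 => i _.
    rewrite -mulrzA; under eq_bigr do rewrite -mulrzA.
    rewrite -mulrz_sumr -mulrzDr [b i * _]mulrC; under eq_bigr do rewrite mulrC.
    by rewrite cAE.
  apply: (subgroupD (subgroup_pmul d)).
    by apply: (subgroupN (subgroup_pmul d)); exact: (subgroupMz (subgroup_pmul d)).
  apply: (subgroup_comb (subgroup_pmul d)) => {}j.
  have [y Ly ->] := AP j; rewrite addrC addKr; exists y => //.
  exact: adic_closure_subset Ly.
(* The coefficient prime to p is thus that of b, so that p divides b by Gauss's lemma. *)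
have pc0 : ~~ (p %| c ord0)%Z by case: (unliftP ord0 j0) pcj0 => [j ->|->//]; rewrite pc.
move=> i; have : (p %| c ord0 * b i)%Z.
  move/eqP: (cAE i); rewrite addr_eq0 => /eqP->; rewrite rpredN.
  by apply: rpred_sum => j _; rewrite dvdz_mulr.
by rewrite Gauss_dvdzr // coprimezE /= prime_coprime.
Qed.

(** Write y = a + p^d b with a in [L], and expand x - p^n a on the l_i modulo p^(d+n) L. This
    difference is p^(d+n) b, so the combination lies in p^(d+n) B and its coefficients are divisible
    by p^n. *)
Lemma lattice_saturated d n x y : adic_indep l d -> adic_closure L y ->
  L x -> x = y *+ p ^ n -> exists2 z, L z & x = z *+ p ^ n.
Proof.
move=> ld yL Lx xE.
have [a [b [La bL yE]]] := closure_lattice_generators d yL.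
have [c [z Lz xaE]] : exists c, exists2 z, L z &
    x - a *+ p ^ n = \sum_i l i *~ c i + z *+ p ^ (d + n).
  by apply: iterate_generators => //; apply: subgroupB => //; exact: subgroupMn.
have pc : forall i, ((p ^ n)%:Z %| c i)%Z.
  apply: adic_indep_dvd ld _ _ _; exists (b - z).
    by apply: (subgroupB subB); [exact: adic_closure_subset bL|exact: LB].
  rewrite mulrnBl -[RHS](addrK (z *+ p ^ (d + n))) -xaE; congr (_ - _).
  by rewrite xE yE mulrnDl addrC addKr -mulrnA -expnD.
exists (a + \sum_i l i *~ divz (c i) (p ^ n)%:Z + z *+ p ^ d).
  by do ?apply: subgroupD; rewrite //; [exact: subgroup_comb|exact: subgroupMn].
rewrite -(subrK (a *+ p ^ n) x) xaE !mulrnDl -mulrnA -expnD addrC addrA; congr (_ + _ + _).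
by rewrite -comb_mulrn; apply: eq_bigr => i _; rewrite divzK.
Qed.

(** For k > d, expand p^k x on the l_i modulo p^k times the closure. The combination lies in p^k B,
    so its coefficients are divisible by p^(k-d), and the whole expansion can be divided by
    p^(k-d). *)
Lemma lattice_torsion_bound d k x : adic_indep l d -> B x ->
  adic_closure L (x *+ p ^ k) -> adic_closure L (x *+ p ^ d).
Proof.
move=> ld Bx; have [kd|dk] := leqP k d => xL.
  rewrite -(subnKC kd) expnD mulrnA.
  by apply: subgroupMn xL; exact: subgroup_adic_closure.
have [c [y Ly xE]] := closure_generators k xL.
have pc : forall i, ((p ^ (k - d))%:Z %| c i)%Z.
  apply: adic_indep_dvd ld _ _ _; rewrite subnKC 1?ltnW//; exists (x - y).
    by apply: (subgroupB subB) => //; exact: adic_closure_subset Ly.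
  by rewrite mulrnBl xE addrK.
have -> : x *+ p ^ d = \sum_i l i *~ divz (c i) (p ^ (k - d))%:Z + y *+ p ^ d.
  apply: (mulrnX_inj tf (k := k - d)).
  rewrite -mulrnA -expnD subnKC 1?ltnW// xE mulrnDl -mulrnA -expnD subnKC 1?ltnW//.
  by rewrite -comb_mulrn; congr (_ + _); apply: eq_bigr => i _; rewrite divzK.
have subcl := subgroup_adic_closure subL.
apply: (subgroupD subcl); last exact: (subgroupMn subcl).
by apply: sub_adic_closure; exact: subgroup_comb.
Qed.

(** The class of x is determined by the coordinates of p^d x on the l_i modulo p^d, for which there
    are finitely many values. *)
Lemma lattice_torsion_finite d (T : set V) :
  (forall x, T x -> adic_closure L (x *+ p ^ d)) ->
  finite_set (coset (adic_closure L) @` T).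
Proof.
move=> Td; have subcl := subgroup_adic_closure subL.
pose C (f : {ffun 'I_t -> 'I_(p ^ d)}) := [set x | exists2 y, adic_closure L y &
  x *+ p ^ d = \sum_i l i *+ f i + y *+ p ^ d].
have CP f x x' : C f x -> C f x' -> coset (adic_closure L) x = coset (adic_closure L) x'.
  have sub z z' : C f z -> C f z' -> coset (adic_closure L) z `<=` coset (adic_closure L) z'.
    move=> [y Ly zE] [y' Ly' z'E] _ [b Lb <-].
    exists (y - y' + b); first by apply: (subgroupD subcl) => //; exact: (subgroupB subcl).
    rewrite addrA; congr (_ + _); rewrite addrC -[RHS](subrK z'); congr (_ + _).
    apply: (mulrnX_inj tf (k := d)); rewrite !mulrnBl zE z'E.
    by rewrite opprD addrACA subrr add0r.
  by move=> Cx Cx'; apply/seteqP; split; exact: sub.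
(* One representative is chosen for each coordinate vector f; the default 0, taken when [C f] is
   empty, only enlarges the finite set. *)
apply: (@sub_finite_set _ _ ((fun f => coset (adic_closure L) (xget 0 (C f))) @` setT)).
  move=> _ [x Tx <-].
  have [c [y Ly xE]] := closure_generators d (Td x Tx).
  have pd0 : (0 < p ^ d)%N by rewrite expn_gt0 prime_gt0.
  have c_lt i : (`|modz (c i) (p ^ d)%:Z| < p ^ d)%N.
    by rewrite -ltz_nat gez0_abs ?modz_ge0 ?ltz_pmod ?lt0r_neq0.
  pose f := [ffun i => Ordinal (c_lt i)]; exists f => //.
  have Cx : C f x.
    exists (\sum_i l i *~ divz (c i) (p ^ d)%:Z + y).
      by apply: (subgroupD subcl) => //; apply: sub_adic_closure; exact: subgroup_comb.
    rewrite xE mulrnDl addrA; congr (_ + _); rewrite -comb_mulrn -big_split/=.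
    apply: eq_bigr => i _; rewrite ffunE /= pmulrn gez0_abs ?modz_ge0 ?lt0r_neq0//.
    by rewrite -mulrzDr addrC -divz_eq.
  by apply: (CP f) => //; apply: xgetPex; exists x.
by apply: finite_image; exact: finite_finset.
Qed.

(** * Scalar multiplication by p-adic integers *)

Section Scaling.
Context (sc : padicInt p -> V -> V).
Hypothesis sep : forall x, (forall k, pmul k x) -> x = 0.
Hypothesis scP : forall a x, B x -> forall n, pmul n (sc a x - x *+ a n).

(** If no d works, there are, for every n, coefficients not all divisible by p whose combination
    lies in p^n B. By compactness they accumulate at a p-adic relation that is nonzero modulo p. *)
Lemma adic_indep_of_padic r (x : 'I_r -> V) : (forall i, B (x i)) ->
  (forall g, \sum_i sc (g i) (x i) = 0 -> forall i, padic_eq0 (g i)) ->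
  exists d, adic_indep x d.
Proof.
move=> Bx xg; apply: contrapT => /forallNP nx.
pose T n (c : 'I_r -> int) := pmul n (\sum_i x i *~ c i) /\ exists i, ~~ (p %| c i)%Z.
have [|n c [cx pc]|n|g gP] := @padic_compactness p r T; first exact: prime_gt0.
- by split=> //; exact: pmul_le cx.
- by have /existsNP[c /not_implyP[cx /existsNP[i /negP pc]]] := nx n; exists c; split=> //; exists i.
have /xg g0 : \sum_i sc (g i) (x i) = 0.
  apply: sep => n; have [c [cx _] cg] := gP n.
  rewrite -(subrK (\sum_i x i *~ c i) (\sum_i _)) -sumrB.
  apply: (subgroupD (subgroup_pmul n)) => //; apply: (subgroup_sum (subgroup_pmul n)) => i.
  rewrite -(subrK (x i *+ g i n) (sc _ _)) -addrA.
  apply: (subgroupD (subgroup_pmul n)); first exact: scP.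
  by rewrite pmulrn -mulrzBr -opprB mulrNz; apply: (subgroupN (subgroup_pmul n)); exact: pmul_dvd.
have [c [_ [i /negP pc]] cg] := gP 1%N.
by apply: pc; have := cg i; rewrite g0 subr0 expn1.
Qed.

Lemma adic_closure_sc a x : adic_closure L x -> adic_closure L (sc a x).
Proof.
have subcl := subgroup_adic_closure subL.
move=> xL; apply: adic_closure_closed => k; exists (x *+ a k).
  exact: (subgroupMn subcl).
by apply: scP; exact: adic_closure_subset xL.
Qed.

(** Iterating [closure_digits], the digit vector of the k-th quotient supplies the k-th p-adic
    digits of the coefficients. *)
Lemma adic_closure_padic_span x : adic_closure L x ->
  exists g : 'I_t -> padicInt p, x = \sum_i sc (g i) (l i).
Proof.
move=> xL.
have /choice[h hP] : forall y, exists d : {ffun 'I_t -> 'I_p} * V, adic_closure L y ->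
    adic_closure L d.2 /\ y = \sum_i l i *+ d.1 i + d.2 *+ p.
  move=> y; have [yL|nyL] := pselect (adic_closure L y).
    by have [d [z zL yE]] := closure_digits yL; exists (d, z).
  by exists ([ffun=> Ordinal (prime_gt0 pp)], 0).
pose y k := iter k (fun z => (h z).2) x.
have yL k : adic_closure L (y k) by elim: k => //= k /hP[].
have /choice[g gE] i := padic_of_digits (fun k => ltn_ord ((h (y k)).1 i)).
exists g; apply/eqP; rewrite -subr_eq0; apply/eqP/sep => n.
have -> : x = \sum_i l i *+ g i n + y n *+ p ^ n.
  elim: n => [|n IH].
    by rewrite expn0 mulr1n big1 ?add0r// => i _; rewrite gE big_ord0 mulr0n.
  rewrite {1}IH {1}(hP _ (yL n)).2 mulrnDl addrA -mulrnA -expnS; congr (_ + _).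
  rewrite -sumrMnl -big_split/=; apply: eq_bigr => i _.
  by rewrite !gE big_ord_recr mulrnDr -mulrnA.
rewrite addrAC -sumrB; apply: (subgroupD (subgroup_pmul n)).
  apply: (subgroup_sum (subgroup_pmul n)) => i; rewrite -opprB.
  by apply: (subgroupN (subgroup_pmul n)); apply: scP; exact: LB.
by exists (y n) => //; exact: adic_closure_subset (yL n).
Qed.

(* a = p ^ k * unit; inverting the unit modulo p ^ N for every N. *)
Lemma padic_torsion a x : B x -> ~ padic_eq0 a -> adic_closure L (sc a x) ->
  exists k, adic_closure L (x *+ p ^ k).
Proof.
have subcl := subgroup_adic_closure subL.
move=> Bx /existsNP[n /eqP an0] aL; exists (logn p (a n)).
apply: adic_closure_closed => N.
pose m := maxn n N.
have nm : (n <= m)%N by exact: leq_maxl.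
have anm := padic_residue_mod a nm.
have an_gt0 : (0 < a n)%N by rewrite lt0n.
have kn : (logn p (a n) < n)%N.
  rewrite -(ltn_exp2l _ _ (prime_gt1 pp)); apply: leq_ltn_trans (residue_lt a n).
  by rewrite dvdn_leq ?pfactor_dvdnn.
have am0 : (0 < a m)%N.
  rewrite lt0n; apply: contraNneq an0 => am0.
  by rewrite am0 mod0n modn_small ?residue_lt// in anm; rewrite -anm.
(* The valuation of [a n] is below n, hence visible modulo p^n, where [a m] and [a n] agree. *)
have am : logn p (a m) = logn p (a n).
  have dvdE j : (j <= n)%N -> (p ^ j %| a m)%N = (p ^ j %| a n)%N.
    by move=> jn; rewrite /dvdn -(modn_dvdm (a m) (dvdn_exp2l p jn)) anm modn_dvdm ?dvdn_exp2l.
  apply/eqP; rewrite eqn_leq; apply/andP; split.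
    by rewrite leqNgt -pfactor_dvdn// dvdE// pfactor_dvdn// ltnn.
  by rewrite -pfactor_dvdn// dvdE ?pfactor_dvdnn// ltnW.
have [c pc] := pfactor_coprime pp am0; rewrite am mulnC => aE.
have /coprimezP[[u w] /= uw] : coprimez c (p ^ m)%N.
  by rewrite coprimezE /= coprime_sym coprimeXl.
(* As u inverts c modulo p^m, multiplying by u turns [a m] into p^k modulo p^m. *)
exists (sc a x *~ u); first exact: (subgroupMz subcl).
have [b Bb bE] := scP a Bx m.
apply: (@pmul_le _ m); first exact: leq_maxr.
rewrite -(subrK (x *+ a m) (sc a x)) -bE mulrzDl opprD addrCA.
have -> : x *+ p ^ logn p (a n) - x *+ a m *~ u = x *+ p ^ logn p (a n) *~ (w * (p ^ m)%N).
  rewrite aE mulrnA [X in _ - X *~ _]pmulrn -mulrzA -{1}[x *+ _]mulr1z -mulrzBr -uw.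
  by congr (_ *~ _); rewrite [c%:Z * u]mulrC addrAC subrr add0r.
apply: (subgroupD (subgroup_pmul m)).
  by apply: (subgroupN (subgroup_pmul m)); apply: (subgroupMz (subgroup_pmul m)); exists b.
by apply: pmul_dvd; [exact: dvdz_mull|exact: subgroupMn].
Qed.

End Scaling.
End Lattice.
End AdicTopology.

(** * The p-adic logarithm *)

(* [m] bounds the ramification: for a discretely valued field the last clause
   holds as soon as 2 ^ m is at least the ramification index. *)
Record padic_field (R : realType) (L : valuedField R) (p m : nat) : Prop :=
  PadicField {
  padic_prime : prime p;
  padic_norm_lt1 : vnorm (p%:R : L) < 1;
  padic_norm_gt0 : 0 < vnorm (p%:R : L);
  padic_complete : forall F : set_system L, ProperFilter F -> cauchy F -> cvg F;
  padic_discrete : forall x : L,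
    vnorm x < 1 -> vnorm x ^+ (2 ^ m) <= vnorm (p%:R : L) }.

Section ValuedFieldTheory.
Context (R : realType) (L : valuedField R).
Implicit Types (x y z : L) (b e : R).

Lemma vnorm_ge0 x : 0 <= vnorm x. Proof. exact: vfield_norm_ge0. Qed.

Lemma vnorm0 : vnorm (0 : L) = 0. Proof. exact/vfield_norm_eq0. Qed.

Lemma vnorm_eq0 x : (vnorm x == 0) = (x == 0).
Proof. by apply/eqP/eqP => [/vfield_norm_eq0|->]; last exact: vnorm0. Qed.

Lemma vnorm_gt0 x : (0 < vnorm x) = (x != 0).
Proof. by rewrite lt_def vnorm_eq0 vnorm_ge0 andbT. Qed.

Lemma vnormM x y : vnorm (x * y) = vnorm x * vnorm y.
Proof. exact: vfield_normM. Qed.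

Lemma vnorm1 : vnorm (1 : L) = 1.
Proof.
have n0 : vnorm (1 : L) != 0 by rewrite vnorm_eq0 oner_eq0.
by apply: (mulfI n0); rewrite -vnormM !mulr1.
Qed.

Lemma vnormX x n : vnorm (x ^+ n) = vnorm x ^+ n.
Proof. by elim: n => [|n IH]; rewrite ?expr0 ?vnorm1// !exprS vnormM IH. Qed.

Lemma vnormN x : vnorm (- x) = vnorm x.
Proof.
rewrite -mulN1r vnormM -[RHS]mul1r; congr (_ * _).
by apply/eqP; rewrite -(eqrXn2 (n := 2)) ?vnorm_ge0// -vnormX sqrrN !expr1n vnorm1.
Qed.

Lemma vnormV x : vnorm x^-1 = (vnorm x)^-1.
Proof.
have [->|x0] := eqVneq x 0; first by rewrite invr0 vnorm0 invr0.
have nx0 : vnorm x != 0 by rewrite vnorm_eq0.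
by apply: (mulfI nx0); rewrite -vnormM !divff// vnorm1.
Qed.

Lemma vnormD_le b x y : vnorm x <= b -> vnorm y <= b -> vnorm (x + y) <= b.
Proof.
by move=> xb yb; apply: le_trans (vfield_normD _ _) _; rewrite ge_max xb yb.
Qed.

Lemma vnormB_le b x y : vnorm x <= b -> vnorm y <= b -> vnorm (x - y) <= b.
Proof. by move=> xb yb; apply: vnormD_le; rewrite ?vnormN. Qed.

Lemma vnormD_lt b x y : vnorm x < b -> vnorm y < b -> vnorm (x + y) < b.
Proof.
by move=> xb yb; apply: le_lt_trans (vfield_normD _ _) _; rewrite gt_max xb yb.
Qed.

Lemma vnormB_lt b x y : vnorm x < b -> vnorm y < b -> vnorm (x - y) < b.
Proof. by move=> xb yb; apply: vnormD_lt; rewrite ?vnormN. Qed.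

Lemma vnormBC x y : vnorm (x - y) = vnorm (y - x).
Proof. by rewrite -opprB vnormN. Qed.

Lemma vnorm_sum_le b (I : Type) (r : seq I) (P : pred I) (F : I -> L) : 0 <= b ->
  (forall i, P i -> vnorm (F i) <= b) -> vnorm (\sum_(i <- r | P i) F i) <= b.
Proof.
move=> b0 Fb; apply: (big_ind (fun z : L => vnorm z <= b)) => //; first by rewrite vnorm0.
by move=> x y; exact: vnormD_le.
Qed.

Lemma vnorm_eq x y : vnorm (x - y) < vnorm y -> vnorm x = vnorm y.
Proof.
move=> xy; apply/eqP; rewrite eq_le; apply/andP; split.
  by rewrite -(subrK y x); apply: vnormD_le => //; exact: ltW.
rewrite leNgt; apply/negP => yx.
have : vnorm (x - (x - y)) < vnorm y by apply: vnormB_lt.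
by rewrite subKr ltxx.
Qed.

Lemma vnorm_nat_le1 n : vnorm (n%:R : L) <= 1.
Proof.
by elim: n => [|n IH]; rewrite ?vnorm0// -natr1; apply: vnormD_le => //; rewrite vnorm1.
Qed.

Lemma vnorm_int_le1 (c : int) : vnorm (c%:~R : L) <= 1.
Proof. by case: c => n; rewrite ?NegzE ?mulrNz ?vnormN; exact: vnorm_nat_le1. Qed.

Lemma vnorm_nat_unit p n : prime p -> vnorm (p%:R : L) < 1 -> ~~ (p %| n)%N -> vnorm (n%:R : L) = 1.
Proof.
move=> pp q_lt1 pn; apply/eqP; rewrite eq_le vnorm_nat_le1 leNgt; apply/negP => n1.
have : coprime p n by rewrite prime_coprime.
case/(coprimeP _ (prime_gt0 pp)) => -[u v] /= uv.
have : vnorm ((u * p)%:R - (v * n)%:R : L) < 1.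
  by apply: vnormB_lt; rewrite natrM vnormM (le_lt_trans (ler_piMl _ (vnorm_nat_le1 _)))// vnorm_ge0.
by rewrite -natrB ?uv ?vnorm1 ?ltxx// ltnW// -subn_gt0 uv.
Qed.

Lemma vnorm_int_unit (p : nat) (c : int) : prime p -> vnorm (p%:R : L) < 1 ->
  ~~ (p %| c)%Z -> vnorm (c%:~R : L) = 1.
Proof.
by case: c => n pp q1 pc; rewrite ?NegzE ?mulrNz ?vnormN -?pmulrn; apply: vnorm_nat_unit pp q1 _.
Qed.

Lemma vnorm_int_dvd (p : nat) (c : int) : (p %| c)%Z -> vnorm (c%:~R : L) <= vnorm (p%:R : L).
Proof.
move=> /dvdzP[b ->]; rewrite rmorphM vnormM /= -pmulrn.
by rewrite ler_piMl ?vnorm_ge0// vnorm_int_le1.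
Qed.

Lemma vlim_eq (u : nat -> L) (l : L) :
  (forall e, 0 < e -> exists N, forall n, (N <= n)%N -> vnorm (l - u n) < e) ->
  lim (u n @[n --> \oo]) = l.
Proof.
move=> ul; apply: (cvg_lim (@metric_hausdorff _ L)).
apply/cvg_ballP => e /ul[N uN]; by exists N => // n /= /uN.
Qed.

Context (p m : nat) (LP : padic_field L p m).
Local Notation q := (vnorm (p%:R : L)).

Let pp : prime p. Proof. by case: LP. Qed.

Let q_lt1 : q < 1. Proof. by case: LP. Qed.

Let q_gt0 : 0 < q. Proof. by case: LP. Qed.

Let complete : forall F : set_system L, ProperFilter F -> cauchy F -> cvg F.
Proof. by case: LP. Qed.

Let disc x : vnorm x < 1 -> vnorm x ^+ (2 ^ m) <= q.
Proof. by case: LP => _ _ _ _; apply. Qed.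

Let q_ge0 : 0 <= q. Proof. exact: ltW. Qed.

Let q_le1 : q <= 1. Proof. exact: ltW. Qed.

Lemma q_exp_small e : 0 < e -> exists N, forall n, (N <= n)%N -> q ^+ n < e.
Proof.
move=> e0; have /cvgrPdist_lt/(_ e e0)[N _ NP] : q ^+ n @[n --> \oo] --> 0.
  by apply: cvg_expr; rewrite ger0_norm.
by exists N => n /NP; rewrite sub0r normrN ger0_norm// exprn_ge0.
Qed.

Lemma scaled_q_exp_small C e : 0 < e -> exists N, forall n, (N <= n)%N -> C * q ^+ n < e.
Proof.
move=> e0; have [C0|C0] := ltrP 0 C.
  have [N NP] := q_exp_small (divr_gt0 e0 C0); exists N => n /NP.
  by rewrite ltr_pdivlMr// mulrC.
by exists 0%N => n _; apply: le_lt_trans e0; rewrite mulr_le0_ge0// exprn_ge0.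
Qed.

Lemma vnorm_natX k : vnorm ((p ^ k)%:R : L) = q ^+ k.
Proof. by rewrite natrX vnormX. Qed.

Lemma vnorm_natX_dvd k n : (p ^ k %| n)%N -> vnorm (n%:R : L) <= q ^+ k.
Proof.
move=> /dvdnP[j ->]; rewrite natrM vnormM vnorm_natX.
by rewrite ler_piMl ?exprn_ge0// vnorm_nat_le1.
Qed.

Lemma vnorm_eq0_geometric C x : (forall n, vnorm x <= C * q ^+ n) -> x = 0.
Proof.
move=> xC; apply/eqP; rewrite -vnorm_eq0 -[_ == _]negbK; apply/negP.
rewrite vnorm_eq0 -vnorm_gt0 => /(scaled_q_exp_small C)[N /(_ N (leqnn N))].
by rewrite ltNge xC.
Qed.

Lemma vnorm_le_geometric C b x (s : nat -> L) :
  (forall n, vnorm (x - s n) <= C * q ^+ n) -> (forall n, vnorm (s n) <= b) ->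
  vnorm x <= b.
Proof.
move=> xs sb; rewrite leNgt; apply/negP => bx.
have [N /(_ N (leqnn N)) CN] := scaled_q_exp_small C (le_lt_trans (le_trans (vnorm_ge0 _) (sb 0%N)) bx).
have : vnorm (x - s N + s N) < vnorm x.
  by apply: vnormD_lt; [exact: le_lt_trans CN|exact: le_lt_trans bx].
by rewrite subrK ltxx.
Qed.

(** By the ultrametric inequality a sum of increments from n on is no larger than their common
    bound. The sequence is therefore Cauchy, and its limit inherits the bound. *)
Lemma vlim_geometric (u : nat -> L) C :
  (forall n, vnorm (u n.+1 - u n) <= C * q ^+ n) ->
  forall n, vnorm (lim (u n @[n --> \oo]) - u n) <= C * q ^+ n.
Proof.
move=> uC.
have C0 : 0 <= C by have := uC 0%N; rewrite expr0 mulr1; apply: le_trans; exact: vnorm_ge0.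
have Cq n k : C * q ^+ (n + k) <= C * q ^+ n.
  by rewrite ler_wpM2l// exprD ler_piMr// ?exprn_ge0// exprn_ile1.
have uB n k : vnorm (u (n + k)%N - u n) <= C * q ^+ n.
  elim: k => [|k IH].
    by rewrite addn0 subrr vnorm0 mulr_ge0// exprn_ge0.
  rewrite -(subrKA (u (n + k)%N)) addnS; apply: vnormD_le => //.
  exact: le_trans (uC _) (Cq _ _).
have cu : cauchy (u n @[n --> \oo]).
  apply/cauchyP => e e0; have [N NC] := scaled_q_exp_small C e0.
  exists (u N); exists N => // n /= Nn.
  rewrite /ball /= -(subnKC Nn) ; apply: le_lt_trans (NC N (leqnn N)).
  by rewrite vnormBC.
have := complete _ cu; move=> /(_ _) ul n.
have : u k @[k --> \oo] --> lim (u n @[n --> \oo]) by exact: ul.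
set l := lim _ => ulim; rewrite leNgt; apply/negP => lt.
have l0 : 0 < vnorm (l - u n) by apply: le_lt_trans lt; rewrite mulr_ge0// exprn_ge0.
have /cvg_ballP/(_ _ l0)[N _ /(_ (n + N)%N)] := ulim.
rewrite /= leq_addl => /(_ isT) lN.
have : vnorm (l - u (n + N)%N + (u (n + N)%N - u n)) < vnorm (l - u n).
  by apply: vnormD_lt => //; apply: le_lt_trans lt.
by rewrite subrKA ltxx.
Qed.

(** Every binomial term of degree at least 2 is an integral multiple of y^2. *)
Lemma exp_p_taylor y : vnorm y <= 1 ->
  vnorm ((1 + y) ^+ p - 1 - y *+ p) <= vnorm y ^+ 2.
Proof.
move=> y1; have [k pE] : exists k, p = k.+2.
  by exists p.-2; rewrite -subn2 -addn2 subnK ?prime_gt1.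
have -> : (1 + y) ^+ p = 1 + (y *+ p + \sum_(i < k.+1) y ^+ i.+2 *+ 'C(p, i.+2)).
  rewrite pE exprDn big_ord_recl big_ord_recl; congr (_ + (_ + _)).
  - by rewrite expr1n mul1r expr0 bin0.
  - by rewrite expr1n mul1r expr1 bin1.
  - by apply: eq_bigr => i _; rewrite expr1n mul1r.
rewrite [1 + _]addrC addrK [y *+ p + _]addrC addrK.
apply: vnorm_sum_le => [|i _]; first by rewrite exprn_ge0// vnorm_ge0.
rewrite -mulr_natr vnormM vnormX -addn2 exprD mulrAC.
rewrite ler_piMl ?exprn_ge0 ?vnorm_ge0// mulr_ile1 ?exprn_ge0 ?vnorm_ge0//.
  by rewrite exprn_ile1 ?vnorm_ge0.
exact: vnorm_nat_le1.
Qed.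

Lemma exp_p_sub1 y : vnorm y <= 1 ->
  vnorm ((1 + y) ^+ p - 1) <= Num.max (q * vnorm y) (vnorm y ^+ 2).
Proof.
move=> y1; rewrite -(subrK (y *+ p) (_ - 1)) le_max.
have [le|lt] := leP (vnorm y ^+ 2) (q * vnorm y); rewrite ?orbT; apply/orP; [left|right].
  apply: vnormD_le; first exact: le_trans (exp_p_taylor y1) le.
  by rewrite -[y *+ p]mulr_natr vnormM mulrC.
apply: vnormD_le; first exact: exp_p_taylor.
by rewrite -[y *+ p]mulr_natr vnormM mulrC ltW.
Qed.

(** * Principal units and the logarithm as a limit of p-power maps *)

Implicit Types u v : L.

Definition principal (u : L) := vnorm (u - 1) < 1.

Lemma principal_norm (u : L) : principal u -> vnorm u = 1.
Proof. by move=> u1; rewrite -vnorm1; apply: vnorm_eq; rewrite vnorm1. Qed.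

Lemma principal1 : principal (1 : L).
Proof. by rewrite /principal subrr vnorm0. Qed.

Lemma principalM (u v : L) : principal u -> principal v -> principal (u * v).
Proof.
move=> u1 v1; have -> : u * v = 1 + (u * (v - 1) + (u - 1)) by ring.
rewrite /principal addrAC subrr add0r; apply: vnormD_lt => //.
by rewrite vnormM (principal_norm u1) mul1r.
Qed.

Lemma principalV (u : L) : principal u -> principal u^-1.
Proof.
move=> u1; have u0 : u != 0 by rewrite -vnorm_eq0 principal_norm// oner_eq0.
have -> : u^-1 = 1 - (u - 1) / u by rewrite mulrBl divff// mul1r opprB addrCA subrr addr0.
by rewrite /principal addrAC subrr add0r vnormN vnormM vnormV (principal_norm u1) invr1 mulr1.
Qed.

Lemma principalX (u : L) n : principal u -> principal (u ^+ n).
Proof. by move=> u1; elim: n => [|n IH]; rewrite ?expr0 ?exprS; [exact: principal1|exact: principalM]. Qed.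

Lemma vnorm_exp_sub1 b (u : L) n : vnorm u <= 1 -> vnorm (u - 1) <= b -> vnorm (u ^+ n - 1) <= b.
Proof.
move=> u1 ub; rewrite subrX1 vnormM; apply: le_trans ub.
rewrite ler_piMr ?vnorm_ge0//; apply: vnorm_sum_le => // i _.
by rewrite vnormX exprn_ile1 ?vnorm_ge0.
Qed.

Definition expp (u : L) n := u ^+ (p ^ n) - 1.

Lemma exppS u n : expp u n.+1 = (1 + expp u n) ^+ p - 1.
Proof. by rewrite /expp [1 + _]addrC subrK expnSr exprM. Qed.

Lemma principal_expp u n : principal u -> vnorm (expp u n) < 1.
Proof. exact: principalX. Qed.

(** A p-th power replaces the distance y to 1 by at most max(q y, y^2). The squares bring it down to
    q after m steps, by discreteness; from then on each step gains a factor q. *)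
Lemma vnorm_expp u n : principal u -> vnorm (expp u (m + n)) <= q ^+ n.+1.
Proof.
move=> u1; elim: n => [|n IH].
  suff le k : vnorm (expp u k) <= Num.max q (vnorm (u - 1) ^+ (2 ^ k)).
    by rewrite addn0 expr1; apply: le_trans (le m) _; rewrite ge_max lexx disc.
  elim: k => [|k IH]; first by rewrite /expp expn0 !expr1 le_max lexx orbT.
  have y1 := ltW (principal_expp k u1).
  rewrite exppS; apply: (le_trans (exp_p_sub1 y1)).
  rewrite ge_max; apply/andP; split; first by rewrite le_max ler_piMr.
  move: IH; rewrite !le_max => /orP[yq|yk]; apply/orP; [left|right].
    by rewrite expr2; apply: le_trans yq; rewrite ler_piMr ?vnorm_ge0.
  by rewrite expnSr exprM lerXn2r// nnegrE ?exprn_ge0 ?vnorm_ge0.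
have y1 := ltW (principal_expp (m + n) u1).
rewrite addnS exppS; apply: (le_trans (exp_p_sub1 y1)); rewrite ge_max; apply/andP; split.
  by rewrite exprS ler_wpM2l.
apply: (@le_trans _ _ ((q ^+ n.+1) ^+ 2)); first by rewrite lerXn2r// nnegrE ?exprn_ge0 ?vnorm_ge0.
by rewrite -exprM ler_wiXn2l//; lia.
Qed.

Lemma vnorm_expp_weak u n : principal u -> vnorm (expp u n) <= q ^+ (n - m).
Proof.
move=> u1; have [nm|mn] := leqP n m.
  by move: nm; rewrite -subn_eq0 => /eqP->; rewrite expr0 ltW// principal_expp.
rewrite -{1}(subnKC (ltnW mn)); apply: le_trans (vnorm_expp _ u1) _.
by rewrite ler_wiXn2l.
Qed.

(** The logarithm as the derivative at 0 of the exponential map k -> u^k along k = p^n. Additivity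
    and the kernel are easier to read off from it than from the series, to which [padic_logE]
    relates it. *)
Definition plog (u : L) : L := lim (expp u n / p%:R ^+ n @[n --> \oo]).

Local Notation C := ((q ^+ (2 * m).+1)^-1).

Let qX_gt0 n : 0 < q ^+ n. Proof. exact: exprn_gt0. Qed.

Let p_neq0 : p%:R != 0 :> L. Proof. by rewrite -vnorm_eq0 gt_eqF. Qed.

(** Consecutive terms differ by a Taylor remainder of size q^(2(n-m)) divided by p^(n+1), that is,
    of norm at most q^(n-2m-1); hence the constant [C]. *)
Lemma plog_approx u n : principal u ->
  vnorm (plog u - expp u n / p%:R ^+ n) <= C * q ^+ n.
Proof.
move=> u1; apply: vlim_geometric => {}n.
have -> : expp u n.+1 / p%:R ^+ n.+1 - expp u n / p%:R ^+ n =
    ((1 + expp u n) ^+ p - 1 - expp u n *+ p) / p%:R ^+ n.+1.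
  rewrite exppS [RHS]mulrBl; congr (_ - _).
  by rewrite exprS -[expp u n *+ p]mulr_natr invfM mulrA mulfK.
rewrite vnormM vnormV vnormX ler_pdivrMr// -mulrA ler_pdivlMl// -exprD.
apply: (@le_trans _ _ (q ^+ (2 * m).+1 * (q ^+ (n - m)) ^+ 2)).
  rewrite ler_wpM2l ?(ltW (qX_gt0 _))//; apply: (le_trans (exp_p_taylor (ltW (principal_expp n u1)))).
  by rewrite lerXn2r ?vnorm_expp_weak// nnegrE ?vnorm_ge0// ltW// qX_gt0.
by rewrite -exprM -exprD ler_wiXn2l//; lia.
Qed.

Lemma C_ge1 : 1 <= C.
Proof. by rewrite invf_ge1// exprn_ile1. Qed.

Lemma plog_bounded u : principal u -> vnorm (plog u) * q ^+ (2 * m).+1 <= 1.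
Proof.
move=> u1; rewrite -ler_pdivlMr// div1r.
have := plog_approx 0 u1; rewrite expr0 divr1 mulr1 /expp expn0 expr1 => lu.
rewrite -(subrK (u - 1) (plog u)); apply: vnormD_le => //.
exact: le_trans (ltW u1) C_ge1.
Qed.

(** Since xy - 1 = (x-1)(y-1) + (x-1) + (y-1), the defect of additivity at stage n is p^n times a
    product of two bounded quotients. *)
Lemma plogM u v : principal u -> principal v -> plog (u * v) = plog u + plog v.
Proof.
move=> u1 v1; have C0 : 0 <= C by exact: le_trans C_ge1.
apply/eqP; rewrite -subr_eq0; apply/eqP; apply: (@vnorm_eq0_geometric (C * C)) => n.
have CC : C * q ^+ n <= C * C * q ^+ n.
  by rewrite ler_wpM2r ?(ltW (qX_gt0 _))// ler_peMl// C_ge1.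
have sB w : principal w -> vnorm (expp w n / p%:R ^+ n) <= C.
  move=> w1; rewrite -(subKr (plog w) (_ / _)); apply: vnormB_le.
    by rewrite -div1r ler_pdivlMr// plog_bounded.
  by apply: le_trans (plog_approx n w1) _; rewrite ler_piMr// exprn_ile1.
have -> : plog (u * v) - (plog u + plog v) =
    plog (u * v) - expp (u * v) n / p%:R ^+ n
    - (plog u - expp u n / p%:R ^+ n) - (plog v - expp v n / p%:R ^+ n)
    + expp u n / p%:R ^+ n * (expp v n / p%:R ^+ n) * p%:R ^+ n.
  have -> : expp (u * v) n = expp u n * expp v n + expp u n + expp v n.
    by rewrite /expp exprMn; ring.
  have P0 : p%:R ^+ n != 0 :> L by rewrite expf_neq0.
  move: (_ ^+ n) P0 => P P0; move: (plog _) (plog _) (plog _) (expp _ _) (expp _ _).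
  by move=> a b c d e; field.
apply: vnormD_le; last first.
  by rewrite vnormM vnormX ler_wpM2r ?(ltW (qX_gt0 _))// vnormM ler_pM ?vnorm_ge0 ?sB.
apply: vnormB_le; last exact: le_trans (plog_approx n v1) CC.
apply: vnormB_le; last exact: le_trans (plog_approx n u1) CC.
by apply: le_trans (plog_approx n _) CC; exact: principalM.
Qed.

Lemma plog1 : plog 1 = 0.
Proof.
have : plog 1 = plog 1 + plog 1.
  by rewrite -{1}(mulr1 1) plogM//; exact: principal1.
by move/eqP; rewrite addrC -subr_eq subrr => /eqP.
Qed.

Lemma plogX u n : principal u -> plog (u ^+ n) = plog u *+ n.
Proof.
move=> u1; elim: n => [|n IH]; first by rewrite expr0 plog1.
by rewrite exprS plogM ?IH ?mulrS//; exact: principalX.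
Qed.

(** Within distance q of 1, each p-th power shrinks the distance by at least the factor q, so every
    approximating quotient has norm at most that of u - 1. *)
Lemma plog_small u : vnorm (u - 1) <= q -> vnorm (plog u) <= vnorm (u - 1).
Proof.
move=> uq; have u1 : principal u by exact: le_lt_trans uq q_lt1.
apply: (@vnorm_le_geometric C _ _ (fun n => expp u n / p%:R ^+ n)) => n.
  exact: plog_approx.
rewrite vnormM vnormV vnormX ler_pdivrMr//.
suff : vnorm (expp u n) <= vnorm (u - 1) * q ^+ n /\ vnorm (expp u n) <= q by case.
elim: n => [|n [IH IHq]]; first by rewrite /expp expn0 expr1 expr0 mulr1.
have y1 := ltW (principal_expp n u1).
have le : vnorm (expp u n.+1) <= q * vnorm (expp u n).
  rewrite exppS; apply: (le_trans (exp_p_sub1 y1)); rewrite ge_max lexx expr2.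
  by rewrite ler_wpM2r ?vnorm_ge0.
split; first by apply: (le_trans le); rewrite exprS mulrCA ler_wpM2l.
by apply: (le_trans le); rewrite ler_piMr.
Qed.

(** The power v lies within q^2 of 1, where the linear Taylor term strictly dominates and a p-th
    power scales the distance to 1 by exactly q. The quotients defining [plog v] = 0 then all have
    the norm of v - 1, which must vanish. *)
Lemma plog_ker u : principal u -> plog u = 0 -> u ^+ (p ^ m.+1) = 1.
Proof.
move=> u1 u0; set v := u ^+ _.
have v1 : principal v by exact: principalX.
have vq : vnorm (v - 1) <= q ^+ 2 by have := vnorm_expp 1 u1; rewrite addn1.
have v0 : plog v = 0 by rewrite plogX// u0 mul0rn.
apply/eqP; rewrite -subr_eq0; apply/eqP; apply: (@vnorm_eq0_geometric C) => n.
have := plog_approx n v1; rewrite v0 sub0r vnormN vnormM vnormV vnormX.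
suff -> : vnorm (expp v n) = vnorm (v - 1) * q ^+ n by rewrite mulfK ?gt_eqF.
have [->|v10] := eqVneq v 1; first by rewrite /expp expr1n subrr vnorm0 mul0r.
elim: n => [|n IH]; first by rewrite /expp expn0 expr1 expr0 mulr1.
have vn_gt0 : 0 < vnorm (expp v n) by rewrite IH mulr_gt0// vnorm_gt0 subr_eq0.
rewrite exppS exprS mulrCA -IH.
have -> : q * vnorm (expp v n) = vnorm (expp v n *+ p) by rewrite -[expp v n *+ p]mulr_natl vnormM.
apply: vnorm_eq; apply: le_lt_trans (exp_p_taylor (ltW (principal_expp n v1))) _.
rewrite -[expp v n *+ p]mulr_natl vnormM expr2 ltr_pM2r// IH.
apply: (@le_lt_trans _ _ (q ^+ 2)); last by rewrite expr2 -[ltRHS]mulr1 ltr_pM2l.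
by apply: le_trans vq; rewrite ler_piMr ?vnorm_ge0// exprn_ile1.
Qed.

(** * Multiples and powers by p-adic integers *)

Lemma padic_residueS (a : padicInt p) n : exists c, a n.+1 = (a n + p ^ n * c)%N.
Proof.
exists (a n.+1 %/ p ^ n)%N; rewrite addnC mulnC {1}(divn_eq (a n.+1) (p ^ n)).
by rewrite residue_coherent modn_small// residue_lt.
Qed.

Lemma vscale_approx (a : padicInt p) x n :
  vnorm (lim (x *+ a n @[n --> \oo]) - x *+ a n) <= vnorm x * q ^+ n.
Proof.
apply: vlim_geometric => {}n; have [c ->] := padic_residueS a n.
rewrite mulrnDr addrC addKr -[x *+ _]mulr_natr vnormM ler_wpM2l ?vnorm_ge0//.
exact/vnorm_natX_dvd/dvdn_mulr.
Qed.

Lemma vexp_approx (a : padicInt p) u n : principal u ->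
  vnorm (lim (u ^+ a n @[n --> \oo]) - u ^+ a n) <= (q ^+ m)^-1 * q ^+ n.
Proof.
move=> u1; apply: vlim_geometric => {}n; have [c ->] := padic_residueS a n.
have -> : u ^+ (a n + p ^ n * c) - u ^+ a n = u ^+ a n * ((u ^+ (p ^ n)) ^+ c - 1).
  by rewrite mulrBr mulr1 -exprM -exprD.
have up : vnorm (u ^+ (p ^ n)) <= 1 by rewrite principal_norm//; exact: principalX.
rewrite vnormM vnormX (principal_norm u1) expr1n mul1r.
apply: le_trans (vnorm_exp_sub1 c up (vnorm_expp_weak n u1)) _.
by rewrite ler_pdivlMl// -exprD ler_wiXn2l//; lia.
Qed.

(** * Comparison with the logarithm series *)

Lemma exp_dominates_log k : exists I, forall i (v : nat), (I <= i)%N -> (p ^ v <= i)%N ->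
  (v + k <= i %/ 2 ^ m)%N.
Proof.
pose N := (2 ^ m)%N; have N0 : (0 < N)%N by rewrite expn_gt0.
(* In the application v is the p-adic valuation of the denominator i. This threshold settles v up to
   2N + k + 1; for larger v, already 2^v exceeds N (v + k). *)
exists (N * (2 * N + k + 1 + k))%N => i v Ii vi; rewrite leq_divRL// -/N mulnC.
have [vV|Vv] := leqP v (2 * N + k + 1).
  by apply: leq_trans Ii; rewrite leq_mul2l leq_add2r vV orbT.
have [w [vE wN]] : exists w, v = (N + w.+1)%N /\ (N + k + 1 <= w.+1)%N.
  by exists (v - N).-1; lia.
apply: leq_trans vi; apply: (@leq_trans (2 ^ v)); last by rewrite leq_exp2r ?prime_gt1// vE addnS.
rewrite vE expnD expnS leq_mul//; first by rewrite ltnW// ltn_expl.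
by have := ltn_expl w (ltnSn 1); lia.
Qed.

Lemma log_term_small x : vnorm x < 1 -> forall e, 0 < e ->
  exists I, forall i, (I <= i)%N -> (0 < i)%N -> vnorm (x ^+ i / i%:R) < e.
Proof.
move=> x1 e /q_exp_small[k /(_ k (leqnn k)) ke].
have [I IP] := exp_dominates_log k; exists I => i Ii i0.
apply: le_lt_trans ke.
have [c pc iE] := pfactor_coprime pp i0; set v := logn p i in iE.
have vi : (p ^ v <= i)%N by rewrite dvdn_leq// pfactor_dvdnn.
have ni : vnorm (i%:R : L) = q ^+ v.
  by rewrite iE natrM vnormM (vnorm_nat_unit pp q_lt1) ?mul1r ?vnorm_natX// -prime_coprime.
rewrite vnormM vnormV ni vnormX ler_pdivrMr// -exprD addnC.
apply: (@le_trans _ _ (q ^+ (i %/ 2 ^ m))); last by rewrite ler_wiXn2l// IP.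
rewrite {1}(divn_eq i (2 ^ m)) exprD mulnC exprM.
rewrite -[leRHS]mulr1 ler_pM ?exprn_ge0 ?vnorm_ge0//; last by rewrite exprn_ile1 ?vnorm_ge0// ltW.
by rewrite lerXn2r ?nnegrE ?exprn_ge0 ?vnorm_ge0// disc.
Qed.

Lemma natr_neq0 n : (0 < n)%N -> n%:R != 0 :> L.
Proof.
move=> n0; have [c pc nE] := pfactor_coprime pp n0.
rewrite -vnorm_eq0 nE natrM vnormM (vnorm_nat_unit pp q_lt1) -?prime_coprime// mul1r vnorm_natX.
by rewrite gt_eqF.
Qed.

(* p ^ n - 1 tends to -1, and 'C(-1, j) = (-1) ^ j. *)
Lemma bin_limit j e : 0 < e -> exists N, forall n, (N <= n)%N ->
  vnorm ('C((p ^ n).-1, j)%:R - (-1) ^+ j : L) < e.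
Proof.
elim: j e => [|j IH] e e0; first by exists 0%N => n _; rewrite bin0 expr0 subrr vnorm0.
have [N1 NP1] := IH e e0.
have [N2 NP2] := scaled_q_exp_small (vnorm (j.+1%:R : L))^-1 e0.
exists (maxn N1 N2) => n; rewrite geq_max => /andP[/NP1 n1 /NP2 n2].
have pn0 : (0 < p ^ n)%N by rewrite expn_gt0 prime_gt0.
have -> : 'C((p ^ n).-1, j.+1)%:R - (-1) ^+ j.+1 =
    'C(p ^ n, j.+1)%:R - ('C((p ^ n).-1, j)%:R - (-1) ^+ j) :> L.
  by rewrite -{2}(prednK pn0) binS natrD exprS mulN1r; ring.
apply: vnormB_lt => //; apply: le_lt_trans n2.
have j0 : j.+1%:R != 0 :> L by exact: natr_neq0.
have nj0 : 0 < vnorm (j.+1%:R : L) by rewrite vnorm_gt0.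
rewrite ler_pdivlMl// -vnormM -natrM -mul_bin_diag.
exact/vnorm_natX_dvd/dvdn_mulr.
Qed.

Lemma vnorm_sum_nat_lt e (a b : nat) (F : nat -> L) : 0 < e ->
  (forall i, (a <= i < b)%N -> vnorm (F i) < e) -> vnorm (\sum_(a <= i < b) F i) < e.
Proof.
move=> e0 Fe; rewrite big_nat.
by apply: (big_ind (fun z : L => vnorm z < e)) => //; [rewrite vnorm0|exact: vnormD_lt].
Qed.

(** From i C(N, i) = N C(N-1, i-1) with N = p^n: the quotient becomes the logarithm series with
    binomial coefficients in place of the signs. *)
Lemma expp_div u n : expp u n / p%:R ^+ n =
  \sum_(1 <= i < (p ^ n).+1) 'C((p ^ n).-1, i.-1)%:R * ((u - 1) ^+ i / i%:R).
Proof.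
have pn0 : (0 < p ^ n)%N by rewrite expn_gt0 prime_gt0.
have E : u ^+ (p ^ n) = 1 + \sum_(i < p ^ n) (u - 1) ^+ i.+1 *+ 'C(p ^ n, i.+1).
  rewrite -{1}(subrK 1 u) [_ + 1]addrC exprDn big_ord_recl; congr (_ + _).
    by rewrite expr1n mul1r expr0 bin0.
  by apply: eq_bigr => i _; rewrite expr1n mul1r.
rewrite big_add1 big_mkord /expp E [1 + _]addrC addrK mulr_suml.
apply: eq_bigr => i _ /=; rewrite -[_ *+ 'C(_, _)]mulr_natr.
have i0 : i.+1%:R != 0 :> L by exact: natr_neq0.
have -> : 'C(p ^ n, i.+1)%:R = p%:R ^+ n * 'C((p ^ n).-1, i)%:R / i.+1%:R :> L.
  by apply: (canRL (mulfK i0)); rewrite -natrX -!natrM mul_bin_diag mulnC.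
have P0 : p%:R ^+ n != 0 :> L by rewrite expf_neq0.
move: (p%:R ^+ n) P0 (i.+1%:R) i0 (_ ^+ i.+1) => P P0 J J0 y.
by field; rewrite J0.
Qed.

(** Below the index [I] the coefficients of [expp_div] converge to the signs of the series by
    [bin_limit]; from [I] on, the terms of both sums are small, uniformly in n, because integers
    have norm at most 1. *)
Lemma padic_logE u : principal u -> padic_log u = plog u.
Proof.
move=> u1; apply: vlim_eq => e e0.
have [I0 IP] := log_term_small u1 e0.
(* The shift makes every index from [I] on positive. *)
pose I := I0.+1.
pose z i := (u - 1) ^+ i / i%:R.
have zI i : (I <= i)%N -> vnorm (z i) < e.
  by move=> Ii; apply: IP; [exact: leq_trans (leqnSn _) Ii|exact: leq_trans Ii].
have [N1 NP1] := scaled_q_exp_small C e0.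
have [N2 NP2] : exists N, forall n, (N <= n)%N -> forall j, (j < I)%N ->
    vnorm (('C((p ^ n).-1, j)%:R - (-1) ^+ j) * z j.+1) < e.
  elim: I {zI} => [|J [N NP]]; first by exists 0%N.
  have z0 : 0 < vnorm (z J.+1) + 1 by rewrite ltr_wpDl ?vnorm_ge0.
  have [N' NP'] := bin_limit J (divr_gt0 e0 z0).
  exists (maxn N N') => n; rewrite geq_max => /andP[nN /NP' nN'] j.
  rewrite ltnS leq_eqVlt => /predU1P[->|jJ]; last exact: NP.
  rewrite vnormM; move: nN'; rewrite ltr_pdivlMr//; apply: le_lt_trans.
  by rewrite ler_wpM2l ?vnorm_ge0// lerDl.
pose n := (N1 + N2 + I)%N.
have In : (I <= (p ^ n).+1)%N.
  by apply: leqW; apply: leq_trans (ltnW (ltn_expl n (prime_gt1 pp))); exact: leq_addl.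
exists I => M IM.
rewrite -(subrK (expp u n / p%:R ^+ n) (plog u)) -addrA; apply: vnormD_lt.
  by apply: le_lt_trans (plog_approx n u1) _; apply: NP1; rewrite /n -addnA leq_addr.
rewrite expp_div (big_cat_nat _ In)//= (big_cat_nat _ IM)//= opprD addrACA.
apply: vnormD_lt; last first.
  apply: vnormB_lt; apply: vnorm_sum_nat_lt => // i /andP[Ii _].
    rewrite vnormM; apply: le_lt_trans (zI i Ii).
    by rewrite ler_piMl ?vnorm_ge0// vnorm_nat_le1.
  by rewrite -mulrA vnormM vnormX vnormN vnorm1 expr1n mul1r zI.
rewrite -sumrB; apply: vnorm_sum_nat_lt => // -[//|i] /= iI.
have -> : (-1) ^+ i.+2 = (-1) ^+ i :> L by rewrite !exprS !mulN1r opprK.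
rewrite -[(-1) ^+ i * _ / _]mulrA -mulrBl; apply: NP2; last exact: ltnW.
by rewrite /n addnAC leq_addl.
Qed.

End ValuedFieldTheory.

(** * Number fields and their completions above p *)

Section NumberField.
Context (K : fieldExtType rat).
Local Notation n := (\dim {: K}).

Lemma numberfield_tf (p : nat) (x : K) : (0 < p)%N -> x *+ p = 0 -> x = 0.
Proof.
move=> p0 /eqP; rewrite -scaler_nat scaler_eq0 pnatr_eq0 => /orP[|/eqP//].
by rewrite eqn0Ngt p0.
Qed.

Lemma numberfield_relation s (x : 'I_s -> K) : (n < s)%N ->
  exists2 c : 'I_s -> int, (exists i, c i != 0) & \sum_i x i *~ c i = 0.
Proof.
move=> ns.
have [c c0 cx] := rat_vectors_relation (\matrix_(i, j) coord (vbasis {:K}) j (x i)) ns.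
exists c => //.
under eq_bigr => i _ do
  rewrite {1}(coord_vbasis (memvf (x i))) -scaler_int scaler_sumr.
rewrite exchange_big big1// => j _.
under eq_bigr do rewrite scalerA.
rewrite -scaler_suml; apply/eqP; rewrite scaler_eq0; apply/orP; left; apply/eqP.
by rewrite -[RHS](cx j); apply: eq_bigr => i _; rewrite mxE.
Qed.

Lemma numberfield_primitive_relation p s (x : 'I_s -> K) : prime p -> (n < s)%N ->
  exists2 c : 'I_s -> int, (exists i, ~~ (p %| c i)%Z) & \sum_i x i *~ c i = 0.
Proof.
move=> pp /numberfield_relation-/(_ x)[c c0 cx].
have [k [d [cd pd]]] := primitive_part pp c0; exists d => //.
apply: (@mulrnX_inj K p _ k) => [y|]; first by apply: numberfield_tf; exact: prime_gt0.
rewrite mul0rn -[RHS]cx -comb_mulrn; apply: eq_bigr => i _.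
by rewrite cd.
Qed.

(** * Ideals of the ring of integers containing p *)

Local Notation O := (integers K).

Lemma integer_val_nat m : integer_val (m%:R : O) = m%:R.
Proof. exact: (rmorph_nat (\val : O -> K)). Qed.

Lemma integers_tf (p : nat) (x : O) : (0 < p)%N -> x *+ p = 0 -> x = 0.
Proof.
move=> p0 xp; apply: val_inj; apply: (numberfield_tf p0).
by rewrite -(raddfMn (\val : O -> K)) xp raddf0.
Qed.

(** Finiteness of O / pO: independent families of integers have at most [K : Q] members, so
    [mod_p_basis] applies to the whole ring. *)
Lemma integers_mod_p (p : nat) : prime p ->
  exists t (l : 'I_t -> O), forall x, exists (d : {ffun 'I_t -> 'I_p}) y,
    x = \sum_i l i *+ d i + y * p%:R.
Proof.
move=> pp; have p0 := prime_gt0 pp.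
have tf (x : O) : x *+ p = 0 -> x = 0 by exact: integers_tf.
have subT : @subgroup O setT by [].
have [|t [l [_ _ lP]]] := @mod_p_basis O p pp tf setT n subT.
  move=> s x _ xc; rewrite leqNgt; apply/negP => /numberfield_relation.
  move=> /(_ (fun i => \val (x i)))[c [i /eqP ci]] cx; apply: ci; apply: xc.
  apply: val_inj; rewrite raddf_sum -[RHS]cx; apply: eq_bigr => j _.
  exact: raddfMz.
exists t, l => x; have [c [y _ xE]] := lP x I.
have c_lt i : (`|modz (c i) p%:Z| < p)%N.
  by rewrite -ltz_nat gez0_abs ?modz_ge0 ?ltz_pmod ?lt0r_neq0.
exists [ffun i => Ordinal (c_lt i)], (\sum_i l i *~ divz (c i) p + y).
rewrite mulr_natr xE mulrnDl addrA; congr (_ + _).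
rewrite -comb_mulrn -big_split/=; apply: eq_bigr => i _.
rewrite ffunE /= pmulrn gez0_abs ?modz_ge0 ?lt0r_neq0//.
by rewrite -mulrzDr addrC -divz_eq.
Qed.

(** In contrast to [idealr_closed] this admits the whole ring, the neutral element for products of
    ideals. *)
Definition ideal (I : set O) := [/\ I 0, forall x y, I x -> I y -> I (x + y)
  & forall a x, I x -> I (a * x)].

Lemma idealP (I : set O) : idealr_closed [in I] <-> ideal I /\ ~ I 1.
Proof.
split=> [[]|[[I0 ID IM] I1]].
  rewrite !inE => I0 I1 IL; have {}IL a x y : I x -> I y -> I (a * x + y).
    by move=> Ix Iy; have := IL a x y; rewrite !inE; apply.
  split=> [|I1']; last by case/negP: I1; exact: mem_set.
  split=> // [x y Ix Iy|a x Ix]; first by rewrite -[x]mul1r; exact: IL.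
  by rewrite -[_ * _]addr0; exact: IL.
split; rewrite ?inE//; first by apply/negP => /set_mem.
by move=> a x y; rewrite !inE => Ix Iy; apply: ID => //; exact: IM.
Qed.

Lemma idealN I x : ideal I -> I x -> I (- x).
Proof. by move=> [_ _ IM] Ix; rewrite -mulN1r; exact: IM. Qed.

Lemma idealB I x y : ideal I -> I x -> I y -> I (x - y).
Proof. by move=> /[dup] idI [_ ID _] Ix Iy; apply: ID => //; exact: idealN. Qed.

Section Residues.
Context (p : nat) (t : nat) (l : 'I_t -> O).
Hypothesis lP : forall x, exists (d : {ffun 'I_t -> 'I_p}) y,
    x = \sum_i l i *+ d i + y * p%:R.

Let residues (I : set O) : {set {ffun 'I_t -> 'I_p}} :=
  [set d : {ffun 'I_t -> 'I_p} | `[< I (\sum_i l i *+ d i) >]]%SET.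

Let residues_subset I J : ideal I -> ideal J -> I p%:R -> J p%:R ->
  residues I \subset residues J -> I `<=` J.
Proof.
move=> idI idJ Ip Jp IJ x; have [d [y ->]] := lP x => Ix.
have [_ JD JM] := idJ; have [_ _ IM] := idI.
apply: JD; last exact: JM.
have : d \in residues I.
  rewrite inE; apply/asboolP; rewrite -[X in I X](addrK (y * p%:R)).
  by apply: idealB => //; exact: IM.
by move=> /(fintype.subsetP IJ); rewrite inE => /asboolP.
Qed.

(** An ideal containing p is recovered from the digit vectors whose combinations it contains. *)
Lemma finite_ideals : finite_set [set I | ideal I /\ I p%:R].
Proof.
apply: (@sub_finite_set _ _ ((fun S : {set {ffun 'I_t -> 'I_p}} =>
  [set x | exists2 d, d \in S & exists y, x = \sum_i l i *+ d i + y * p%:R]) @` setT)).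
  move=> I [idI Ip]; exists (residues I) => //; have [_ ID IM] := idI.
  apply/seteqP; split=> [x [d]|x Ix] /=.
    by rewrite inE => /asboolP Id [y ->]; apply: ID => //; exact: IM.
  have [d [y xE]] := lP x; exists d; last by exists y.
  rewrite inE; apply/asboolP; rewrite -[X in I X](addrK (y * p%:R)) -xE.
  by apply: idealB => //; exact: IM.
exact/finite_image/finite_finset.
Qed.

(* A proper ideal containing p with the largest number of residues modulo p is
   maximal. *)
Lemma exists_prime_ideal : (forall y : O, y * p%:R <> 1) ->
  primes_above K p !=set0.
Proof.
move=> p_nunit.
pose proper I := [/\ ideal I, I p%:R & ~ I 1].
pose N k := `[< exists2 I, proper I & #|residues I| = k >].
have N0 : exists k, N k.
  exists #|residues [set y * p%:R | y in setT]|; apply/asboolP.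
  exists [set y * p%:R | y in setT]; split=> //; last by move=> [y _ /p_nunit].
    split=> [|_ _ [x _ <-] [y _ <-]|a _ [x _ <-]]; first by exists 0; rewrite ?mul0r.
      by exists (x + y); rewrite ?mulrDl.
    by exists (a * x); rewrite ?mulrA.
  by exists 1; rewrite ?mul1r.
have Nmax k : N k -> (k <= #|{: {ffun 'I_t -> 'I_p}}|)%N.
  by move=> /asboolP[I _ <-]; exact: max_card.
case: (ex_maxnP N0 Nmax) => _ /asboolP[I [idI Ip I1] <-] Imax.
have [I0 ID IM] := idI.
exists I; split=> //; split; first by apply/idealP.
move=> u v; rewrite !inE => Iuv; apply/orP.
have [Iu|nIu] := pselect (I u); [by left; rewrite inE|right; rewrite inE].
(* [J] is I + (u). If it contains 1, multiplying by v puts v in I; otherwise it contradicts the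
   maximality of I. *)
pose J := [set x | exists2 i, I i & exists y, x = i + y * u].
have IJ : I `<=` J by move=> x Ix; exists x => //; exists 0; rewrite mul0r addr0.
have idJ : ideal J.
  split=> [|_ _ [x Ix [a ->]] [y Iy [b ->]]|c _ [x Ix [a ->]]]; first exact: IJ.
    by exists (x + y); [exact: ID|exists (a + b); rewrite mulrDl addrACA].
  by exists (c * x); [exact: IM|exists (c * a); rewrite mulrDr mulrA].
have [J1|nJ1] := pselect (J 1).
  have [i Ii [y yu]] := J1; rewrite -[v]mul1r yu mulrDl; apply: ID.
    by rewrite mulrC; exact: IM.
  by rewrite -mulrA; exact: IM.
have /Imax : N #|residues J| by apply/asboolP; exists J => //; split=> //; exact: IJ.
have sIJ : residues I \subset residues J.
  apply/fintype.subsetP => d; rewrite [d \in residues I]inE [d \in residues J]inE => /asboolP Id.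
  by apply/asboolP; exact: IJ.
rewrite leqNgt => /negP; case; apply: proper_card; rewrite properE sIJ.
apply/negP => /(residues_subset idJ idI (IJ _ Ip) Ip)/(_ u) JI.
by apply: nIu; apply: JI; exists 0 => //; exists 1; rewrite mul1r add0r.
Qed.

End Residues.

(** If y = 1/p satisfied a monic equation of degree d, multiplying it by p^d would express 1 as an
    integer combination of positive powers of p. *)
Lemma integers_p_nunit (p : nat) (y : O) : prime p -> y * p%:R <> 1.
Proof.
move=> pp yp.
have [r rmon] : integralOver (intr : int -> K) (integer_val y).
  by have := integer_valP y; rewrite /in_mem /= => /asboolP.
have zp : integer_val y * p%:R = 1.
  by rewrite -integer_val_nat -[LHS](rmorphM (\val : O -> K)) yp (rmorph1 (\val : O -> K)).
have [d rd] : exists d, size r = d.+1.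
  by exists (size r).-1; rewrite prednK// size_poly_gt0 monic_neq0.
have rd1 : r`_d = 1 by move/monicP: rmon; rewrite /lead_coef rd.
rewrite /root /map_poly horner_poly => /eqP/(congr1 ( *%R^~ (p%:R ^+ d))).
rewrite mul0r mulr_suml rd.
have E (i : 'I_d.+1) : (r`_i)%:~R * integer_val y ^+ i * p%:R ^+ d = (r`_i * (p ^ (d - i))%:Z)%:~R.
  have id : (i <= d)%N by rewrite -ltnS.
  have -> : p%:R ^+ d = p%:R ^+ i * p%:R ^+ (d - i) :> K by rewrite -exprD subnKC.
  rewrite -mulrA [integer_val y ^+ i * _]mulrA -exprMn zp expr1n mul1r.
  by rewrite rmorphM/= -pmulrn natrX.
under eq_bigr do rewrite E.
rewrite -(rmorph_sum (intr : int -> K)).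
have inj (c : int) : c%:~R = 0 :> K -> c = 0.
  move/eqP; rewrite -scaler_int scaler_eq0 oner_eq0 orbF intr_eq0 => /eqP//.
move=> /inj; rewrite big_ord_recr /= rd1 subnn expn0 mulr1 => /eqP.
rewrite addr_eq0; set S := \sum_(i < d) _ => /eqP SE; have : (p %| S)%Z.
  apply: rpred_sum => i _; apply: dvdz_mull.
  by rewrite dvdzE /= dvdn_exp// subn_gt0.
by rewrite SE dvdzE /= dvdn1 => /eqP p1; rewrite p1 in pp.
Qed.

Lemma primes_above_neq0 p : prime p -> primes_above K p !=set0.
Proof.
move=> pp; have [t [l lP]] := integers_mod_p pp.
by apply: exists_prime_ideal lP _ => y; exact: integers_p_nunit.
Qed.

Lemma finite_primes_above p : prime p -> finite_set (primes_above K p).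
Proof.
move=> /integers_mod_p[t [l lP]]; apply: sub_finite_set (finite_ideals lP) => P [[idP _] Pp].
by have /idealP[] := idP.
Qed.

End NumberField.

(** * The modulus above p and the group of principal units *)

Section PrincipalUnits.
Context (K : fieldExtType rat) (p : nat).
Hypothesis pp : prime p.
Local Notation O := (integers K).

Lemma ideal_idealM (I J : set O) : ideal I -> ideal J -> ideal (idealM I J).
Proof.
move=> [I0 ID IM] [J0 JD JM]; split.
- by exists 0%N, (fun=> 0), (fun=> 0); split=> [[]//|[]//|]; rewrite big_ord0.
- move=> _ _ [n [a [b [Ia Jb ->]]]] [n' [a' [b' [Ia' Jb' ->]]]].
  exists (n + n')%N, (fun i => match fintype.split i with inl j => a j | inr j => a' j end),
    (fun i => match fintype.split i with inl j => b j | inr j => b' j end).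
  split=> [i|i|]; [by case: (fintype.split i)|by case: (fintype.split i)|].
  rewrite big_split_ord/=; congr (_ + _); apply: eq_bigr => i _.
    by rewrite (unsplitK (inl i)).
  by rewrite (unsplitK (inr i)).
- move=> c _ [n [a [b [Ia Jb ->]]]]; exists n, (fun i => c * a i), b.
  split=> [i||]; [exact: IM|exact: Jb|].
  by rewrite mulr_sumr; apply: eq_bigr => i _; rewrite mulrA.
Qed.

Lemma idealM_subl (I J : set O) : ideal I -> idealM I J `<=` I.
Proof.
move=> [I0 ID IM] _ [n [a [b [Ia _ ->]]]].
by apply: (big_ind I) => // i _; rewrite mulrC; exact: IM.
Qed.

Lemma idealM_subr (I J : set O) : ideal J -> idealM I J `<=` J.
Proof.
by move=> [J0 JD JM] _ [n [a [b [_ Jb ->]]]]; apply: (big_ind J) => // i _; exact: JM.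
Qed.

Lemma prime_ideal_ideal (P : set O) : prime_ideal P -> ideal P /\ ~ P 1.
Proof. by move=> [/idealP]. Qed.

Let modulus : set O := \big[@idealM K/setT]_(P \in primes_above K p) P.

(** The iterated product skips the indices equal to its neutral element [setT]; a prime ideal is
    proper, so none is skipped. *)
Let support_primes :
  finite_support setT (primes_above K p) id =i (primes_above K p : set _).
Proof.
move=> P; rewrite in_finite_support; last first.
  by apply: (sub_finite_set _ (finite_primes_above K pp)); exact: subIsetl.
apply/idP/idP; rewrite !inE; first by case.
move=> Pp; split=> //= PT; case: Pp => /prime_ideal_ideal[_ P1] _.
by apply: P1; rewrite PT.
Qed.

Let ideal_modulus : ideal modulus.
Proof.
rewrite /modulus big_seq; apply: (big_ind (@ideal K)) => //; first exact: ideal_idealM.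
by move=> P; rewrite support_primes inE => -[/prime_ideal_ideal[]].
Qed.

Let modulus_subset (P : set O) : primes_above K p P -> modulus `<=` P.
Proof.
move=> Pp; have [[idP nP1] _] : (ideal P /\ ~ P 1) /\ P p%:R.
  by case: Pp => /prime_ideal_ideal.
have : P \in finite_support setT (primes_above K p) id by rewrite support_primes inE.
have : forall Q, Q \in finite_support setT (primes_above K p) id -> ideal Q.
  by move=> Q; rewrite support_primes inE => -[/prime_ideal_ideal[]].
rewrite /modulus; elim: (finite_support _ _ _) => //= Q s IH sid.
have idQ : ideal Q by apply: sid; exact: mem_head.
have sid' Q' : Q' \in s -> ideal Q' by move=> Qs; apply: sid; rewrite inE Qs orbT.
rewrite big_cons inE => /predU1P[->|/(IH sid') sP]; first exact: idealM_subl.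
apply: subset_trans sP; apply: idealM_subr; rewrite big_seq.
by apply: (big_ind (@ideal K)) => //; exact: ideal_idealM.
Qed.

Let unitE (e : K) : principal_units K p e <->
  exists2 x : O, integer_val x = e & integer_unit x /\ modulus (x - 1).
Proof. by split=> [[x ? <-]|[x <- ?]]; exists x. Qed.

Lemma principal_units1 : principal_units K p 1.
Proof.
apply/unitE; exists 1; first exact: (rmorph1 (\val : O -> K)).
split; first by exists 1; rewrite mulr1.
by rewrite subrr; case: ideal_modulus.
Qed.

Lemma principal_unitsM e f :
  principal_units K p e -> principal_units K p f -> principal_units K p (e * f).
Proof.
move=> /unitE[x <- [[x' xx'] x1]] /unitE[y <- [[y' yy'] y1]].
apply/unitE; exists (x * y); first exact: (rmorphM (\val : O -> K)).
split; first by exists (x' * y'); rewrite mulrACA xx' yy' mulr1.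
have [_ MD MM] := ideal_modulus.
have -> : x * y - 1 = x * (y - 1) + (x - 1) by ring.
by apply: MD => //; exact: MM.
Qed.

Lemma principal_unitsV e : principal_units K p e -> principal_units K p e^-1.
Proof.
move=> /unitE[x <- [[x' xx'] x1]].
have xV : integer_val x' = (integer_val x)^-1.
  have xx1 : integer_val x * integer_val x' = 1.
    by rewrite -[LHS](rmorphM (\val : O -> K)) xx' (rmorph1 (\val : O -> K)).
  by rewrite -[RHS]mulr1 -xx1 mulKf//; apply: contra_eq_neq xx1 => ->; rewrite mul0r eq_sym oner_eq0.
apply/unitE; exists x' => //; split; first by exists x; rewrite mulrC.
have [_ _ MM] := ideal_modulus; have -> : x' - 1 = (- x') * (x - 1).
  by rewrite mulrBr mulNr mulr1 mulrC xx' opprK addrC.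
exact: MM.
Qed.

Lemma principal_unitsX e n : principal_units K p e -> principal_units K p (e ^+ n).
Proof.
by move=> Ee; elim: n => [|n IH]; rewrite ?expr0 ?exprS; [exact: principal_units1|exact: principal_unitsM].
Qed.

Lemma principal_units_neq0 e : principal_units K p e -> e != 0.
Proof.
move=> /unitE[x <- [[x' xx'] _]]; apply/eqP => x0.
have : integer_val x * integer_val x' = 1.
  by rewrite -[LHS](rmorphM (\val : O -> K)) xx' (rmorph1 (\val : O -> K)).
by rewrite x0 mul0r => /eqP; rewrite eq_sym oner_eq0.
Qed.

Lemma principal_units_prime e P : principal_units K p e -> primes_above K p P ->
  exists2 x : O, P x & e - 1 = integer_val x.
Proof.
move=> /unitE[x <- [_ x1]] Pp; exists (x - 1); first exact: modulus_subset Pp _ x1.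
by have := rmorphB (\val : O -> K) x 1; rewrite (rmorph1 (\val : O -> K)) => <-.
Qed.

End PrincipalUnits.

(** * Completions at the primes above p *)

Section Completion.
Context (R : realType) (K : fieldExtType rat) (p : nat).
Hypothesis pp : prime p.
Context (P : set (integers K)) (L : adicCompletion R P).
Hypothesis Pp : primes_above K p P.

Lemma completion_principal (x : integers K) : P x -> vnorm (completion_map L (integer_val x)) < 1.
Proof.
move=> Px; have [c /andP[c0 c1] cP] := completion_adic L.
apply: le_lt_trans c1; rewrite -[c]expr1; apply/cP.
by exists 1%N, (fun=> x), (fun=> 1); split=> //; rewrite big_ord1 mulr1.
Qed.

(** For discreteness, density replaces x by some y in K of the same norm. If the norm of y^(2^n)
    exceeded q, with n = [K : Q], consider an integer relation, nonzero modulo p, between 1, y, ...,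
    y^n. Terms with coefficient prime to p have distinct norms above q, the others have norm at most
    q, so a single term dominates: a contradiction. *)
Lemma completion_padic : padic_field L p (\dim {: K}).
Proof.
have q1 : vnorm (p%:R : L) < 1.
  rewrite -(rmorph_nat (completion_map L)) -integer_val_nat.
  by apply: completion_principal; case: Pp.
have q0 : 0 < vnorm (p%:R : L).
  rewrite vnorm_gt0 -(rmorph_nat (completion_map L)) fmorph_eq0.
  by rewrite -scaler_nat scaler_eq0 oner_eq0 orbF pnatr_eq0 -lt0n prime_gt0.
split=> // [|x x1]; first exact: completion_complete.
have [->|x0] := eqVneq x 0.
  by rewrite vnorm0 expr0n expn_eq0 /= ltW.
have [y xy] : exists y : K, vnorm (x - completion_map L y) < vnorm x.
  have x_gt0 : 0 < vnorm x by rewrite vnorm_gt0.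
  have [ob xb] := open_nbhs_ball x (PosNum x_gt0).
  have [|z [/interior_subset xz [y _ yz]]] := @completion_dense _ _ _ L _ _ ob.
    by exists x.
  by exists y; rewrite yz.
have yx : vnorm (completion_map L y) = vnorm x by apply: vnorm_eq; rewrite vnormBC.
rewrite -yx; set z := completion_map L y in xy yx *.
have z1 : vnorm z < 1 by rewrite yx.
have z0 : 0 < vnorm z by rewrite yx vnorm_gt0.
pose n := \dim {: K}; rewrite -/n leNgt; apply/negP => qz.
have qzi i : (i <= n)%N -> vnorm (p%:R : L) < vnorm z ^+ i.
  move=> in_; apply: (lt_le_trans qz); apply: ler_wiXn2l; rewrite ?vnorm_ge0 ?(ltW z1)//.
  by rewrite (leq_trans in_)// ltnW// ltn_expl.
have [c [j0 pj0] cy] := numberfield_primitive_relation (fun i : 'I_n.+1 => y ^+ i) pp (ltnSn n).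
have cz : \sum_(i < n.+1) z ^+ i * (c i)%:~R = 0.
  have := congr1 (completion_map L) cy; rewrite rmorph0 rmorph_sum /= => E; rewrite -[RHS]E.
  apply: eq_bigr => i _.
  by rewrite -[y ^+ i *~ _]mulrzr rmorphM rmorphXn rmorph_int.
have [i pi imin] := @arg_minnP _ j0 (fun j => ~~ (p %| c j)%Z) (fun j : 'I_n.+1 => j : nat) pj0.
have z_lt j k : (j < k)%N -> vnorm z ^+ k < vnorm z ^+ j.
  by move=> jk; rewrite ltr_iXn2l.
have : vnorm (z ^+ i * (c i)%:~R) < vnorm z ^+ i.
  move/eqP: cz; rewrite (bigD1 i)//= addr_eq0 => /eqP->; rewrite vnormN.
  apply: (big_ind (fun w : L => vnorm w < vnorm z ^+ i)) => [||j ji].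
  - by rewrite vnorm0 exprn_gt0.
  - exact: vnormD_lt.
  rewrite vnormM vnormX; have [pj|pj] := boolP (p %| c j)%Z.
    apply: le_lt_trans (qzi i _); last by rewrite -ltnS.
    apply: le_trans (vnorm_int_dvd L pj).
    by rewrite ler_piMl ?vnorm_ge0// exprn_ile1 ?vnorm_ge0// ltW.
  rewrite (vnorm_int_unit pp q1 pj) mulr1 z_lt// ltn_neqAle imin// andbT.
  by rewrite eq_sym.
by rewrite vnormM (vnorm_int_unit pp q1 pi) mulr1 vnormX ltxx.
Qed.

End Completion.


(** * Principal local units *)

Section LocalSumTheory.
Context (R : realType) (K : fieldExtType rat) (p : nat).
Context (Kp : forall P : primes_above K p, adicCompletion R (val P)).
Hypothesis pp : prime p.

Local Notation V := (local_sum Kp).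
Local Notation E := (principal_units K p).
Local Notation U := (local_units Kp).
Local Notation m := (\dim {: K}).
Local Notation M := (2 * \dim {: K}).+1.
Local Notation q P := (vnorm (p%:R : Kp P)).

Implicit Types (x y u v : V) (P : primes_above K p).

Let LP P : padic_field (Kp P) p m.
Proof. exact: (completion_padic pp (Kp P) (set_valP P)). Qed.

Let q_lt1 P : q P < 1. Proof. by case: (LP P). Qed.
Let q_gt0 P : 0 < q P. Proof. by case: (LP P). Qed.
Let q_ge0 P : 0 <= q P. Proof. exact: ltW. Qed.
Let q_le1 P : q P <= 1. Proof. exact: ltW. Qed.
Let qX_gt0 P n : 0 < q P ^+ n. Proof. exact: exprn_gt0. Qed.
Let p_neq0 P : p%:R != 0 :> Kp P.
Proof. by rewrite -vnorm_eq0 gt_eqF. Qed.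

Lemma local_sumP x y : (forall P, x P = y P) -> x = y.
Proof. exact: functional_extensionality_dep. Qed.

Lemma lsD x y P : (x + y) P = x P + y P. Proof. by []. Qed.
Lemma lsN x P : (- x) P = - x P. Proof. by []. Qed.
Lemma lsM x y P : (x * y) P = x P * y P. Proof. by []. Qed.

Lemma lsMn x n P : (x *+ n) P = x P *+ n.
Proof. by elim: n => [//|n IH]; rewrite !mulrS lsD IH. Qed.

Lemma lsX x n P : (x ^+ n) P = x P ^+ n.
Proof. by elim: n => [//|n IH]; rewrite !exprS lsM IH. Qed.

Lemma local_sum_tf x : x *+ p = 0 -> x = 0.
Proof.
move=> xp; apply: local_sumP => P; have /eqP := congr1 (fun z : V => z P) xp.
by rewrite lsMn -mulr_natr mulf_eq0 (negbTE (p_neq0 P)) orbF => /eqP.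
Qed.

(* M is chosen so that this lattice contains the logarithms of all principal
   local units. *)
Definition log_lattice : set V := [set x : V | forall P, vnorm (x P) * q P ^+ M <= 1].

Local Notation B := log_lattice.

Lemma subgroup_log_lattice : subgroup B.
Proof.
split=> [P|x y Bx By P]; first by rewrite vnorm0 mul0r.
by move: (Bx P) (By P); rewrite -!ler_pdivlMr// lsD lsN; exact: vnormB_le.
Qed.

Lemma pmulP k x : pmul p B k x <-> forall P, vnorm (x P) * q P ^+ M <= q P ^+ k.
Proof.
split=> [[b Bb <-] P|xk].
  by rewrite lsMn -[b P *+ _]mulr_natr vnormM natrX vnormX mulrAC ler_piMl ?(ltW (qX_gt0 _ _)).
exists (fun P => x P / p%:R ^+ k) => [P|].
  by rewrite vnormM vnormV vnormX mulrAC ler_pdivrMr// mul1r.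
apply: local_sumP => P; rewrite lsMn -[_ *+ (p ^ k)]mulr_natr natrX divfK//.
by rewrite expf_neq0// p_neq0.
Qed.

Lemma log_lattice_sep x : (forall k, pmul p B k x) -> x = 0.
Proof.
move=> xk; apply: local_sumP => P.
apply: (vnorm_eq0_geometric (LP P) (C := (q P ^+ M)^-1)) => n.
by rewrite mulrC ler_pdivlMr//; move/pmulP: (xk n).
Qed.

Lemma Zp_scaleP (a : padicInt p) x : B x ->
  forall n, pmul p B n (Zp_scale a x - x *+ a n).
Proof.
move=> Bx n; apply/pmulP => P; rewrite lsD lsN lsMn.
apply: (le_trans (ler_wpM2r (ltW (qX_gt0 _ _)) (vscale_approx (LP P) a (x P) n))).
by rewrite mulrAC ler_piMl ?(ltW (qX_gt0 _ _))//; exact: Bx.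
Qed.

Lemma local_unitsP u : U u <-> forall P, principal (u P).
Proof.
split=> [[_ [x x1 ->]] P|u1].
  by rewrite /principal lsD addrAC subrr add0r; exact: x1.
split=> [P|]; first by rewrite -vnorm_eq0 (principal_norm (u1 P)) oner_eq0.
exists (u - 1) => [P|]; first exact: u1.
by rewrite addrC subrK.
Qed.

Lemma local_units_principal u P : U u -> principal (u P).
Proof. by move=> /local_unitsP. Qed.

Lemma local_units1 : U 1.
Proof. by apply/local_unitsP => P; exact: principal1. Qed.

Lemma local_unitsM u v : U u -> U v -> U (u * v).
Proof.
by move=> /local_unitsP Uu /local_unitsP Uv; apply/local_unitsP => P; exact: principalM.
Qed.

Lemma local_unitsX u n : U u -> U (u ^+ n).
Proof.
by move=> Uu; elim: n => [|n IH]; rewrite ?expr0 ?exprS; [exact: local_units1|exact: local_unitsM].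
Qed.

Lemma local_units_inv u : U u -> exists2 v, U v & u * v = 1.
Proof.
move=> /local_unitsP Uu; exists (fun P => (u P)^-1).
  by apply/local_unitsP => P; exact: principalV.
apply: local_sumP => P; rewrite lsM divff//.
by rewrite -vnorm_eq0 (principal_norm (Uu P)) oner_eq0.
Qed.

Lemma local_logE u P : U u -> local_log Kp u P = plog p (u P).
Proof. by move=> /local_unitsP Uu; exact: padic_logE (LP P) _ (Uu P). Qed.

Lemma local_log_lattice u : U u -> B (local_log Kp u).
Proof.
by move=> Uu P; rewrite local_logE//; apply: (plog_bounded (LP P)); exact: local_units_principal.
Qed.

Lemma local_logM u v : U u -> U v ->
  local_log Kp (u * v) = local_log Kp u + local_log Kp v.
Proof.
move=> Uu Uv; apply: local_sumP => P; rewrite lsD !local_logE//; last exact: local_unitsM.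
by rewrite lsM; apply: (plogM (LP P)); exact: local_units_principal.
Qed.

Lemma local_log1 : local_log Kp 1 = 0.
Proof. by apply: local_sumP => P; rewrite local_logE ?(plog1 (LP P))//; exact: local_units1. Qed.

Lemma local_logX u n : U u -> local_log Kp (u ^+ n) = local_log Kp u *+ n.
Proof.
move=> Uu; elim: n => [|n IH]; first by rewrite expr0 local_log1.
by rewrite exprS local_logM ?IH ?mulrS//; exact: local_unitsX.
Qed.

Lemma local_log_ker u : U u -> local_log Kp u = 0 -> u ^+ (p ^ m.+1) = 1.
Proof.
move=> Uu u0; apply: local_sumP => P; rewrite lsX.
apply: (plog_ker (LP P)); first exact: local_units_principal.
by rewrite -local_logE// u0.
Qed.

Lemma local_log_inj u v : U u -> U v -> local_log Kp u = local_log Kp v ->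
  u ^+ (p ^ m.+1) = v ^+ (p ^ m.+1).
Proof.
move=> Uu Uv uv; have [w Uw vw] := local_units_inv Uv.
have : local_log Kp (u * w) = 0 by rewrite local_logM// uv -local_logM// vw local_log1.
move=> /(local_log_ker (local_unitsM Uu Uw)); rewrite exprMn => uw1.
by rewrite -[LHS]mulr1 -[X in _ * X](expr1n _ (p ^ m.+1)) -vw exprMn mulrCA uw1 mulr1.
Qed.

(** * Congruences modulo p^k and the product topology *)

Definition lclose k u v := forall P, vnorm (u P - v P) <= q P ^+ k.

(** The difference is the logarithm of u/v, which is congruent to 1 modulo p^(k+1); the exponent is
    at least 1, as [plog_small] demands. *)
Lemma local_log_lclose k u v : U u -> U v -> lclose k.+1 u v ->
  pmul p B k.+1 (local_log Kp u - local_log Kp v).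
Proof.
move=> Uu Uv uv; have [w Uw vw] := local_units_inv Uv.
have -> : local_log Kp u - local_log Kp v = local_log Kp (u * w).
  have -> : local_log Kp u = local_log Kp (v * (u * w)) by rewrite mulrCA vw mulr1.
  by rewrite (local_logM Uv (local_unitsM Uu Uw)) [X in X - _]addrC addrK.
apply/pmulP => P; rewrite local_logE; last exact: local_unitsM.
have uw : vnorm ((u * w) P - 1) <= q P ^+ k.+1.
  have -> : (u * w) P - 1 = (u P - v P) * w P.
    by rewrite mulrBl; congr (_ - _); have := congr1 (fun z : V => z P) vw.
  by rewrite vnormM (principal_norm (local_units_principal P Uw)) mulr1.
apply: (@le_trans _ _ (vnorm (plog p ((u * w) P)))).
  by rewrite ler_piMr ?vnorm_ge0// exprn_ile1.
apply: (le_trans _ uw); apply: (plog_small (LP P)); apply: (le_trans uw).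
by rewrite exprS ler_piMr// exprn_ile1.
Qed.

Lemma nbhs_local_sum x (A : set V) (s : nat -> V) : nbhs x A ->
  (forall k, lclose k x (s k)) -> exists k, A (s k).
Proof.
move=> xA sx; suff : s k @[k --> \oo] --> x.
  by move=> /(_ _ xA)[N _ /(_ N (leqnn N))]; exists N.
apply/cvg_sup => P; apply/cvg_image.
  by apply/seteqP; split=> // y _; exists (dfwith x P y) => //; rewrite dfwithin.
move=> Q xQ; exists ((fun y : V => y P) @^-1` Q); last first.
  by apply: image_preimage; apply/seteqP; split=> // y _; exists (dfwith x P y) => //; rewrite dfwithin.
have [e /= e0 eQ] := (nbhs_ballP _ _).1 xQ.
have [N NP] := q_exp_small (LP P) e0; exists N => // k /= Nk.
by apply: eQ; apply: le_lt_trans (NP k Nk); exact: sx.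
Qed.

(** Only finitely many primes lie above p, so this is a finite intersection of conditions on single
    components. *)
Lemma lclose_nbhs x k : nbhs x [set y | lclose k x y].
Proof.
have [s sP] : exists s : seq (set (integers K)), forall Q, primes_above K p Q -> Q \in s.
  by have /finite_seqP[s sE] := finite_primes_above K pp; exists s => Q; rewrite sE.
suff : nbhs x [set y : V | forall P, val P \in s -> vnorm (x P - y P) <= q P ^+ k].
  apply: filterS => y xy P; apply: xy.
  exact/sP/set_valP.
elim: s {sP} => [|Q s IH]; first by apply: filterE => y P.
have [Qp|nQp] := pselect (primes_above K p Q); last first.
  apply: filterS IH => y xy P; rewrite inE => /predU1P[PQ|]; last exact: xy.
  by case: nQp; rewrite -PQ; exact: set_valP.
pose P0 : primes_above K p := SigSub (mem_set Qp).
have xP0 : nbhs x [set y : V | vnorm (x P0 - y P0) < q P0 ^+ k].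
  have pc := @proj_continuous _ (fun P => Kp P) P0 x.
  have xb := nbhsx_ballx (x P0) _ (qX_gt0 P0 k).
  exact: (pc _ xb).
apply: filterS (filterI xP0 IH) => y [yP0 ys] P; rewrite inE => /predU1P[PQ|]; last exact: ys.
have -> : P = P0 by exact: val_inj.
exact: ltW yP0.
Qed.

Lemma closureP (A : set V) x : closure A x <-> forall k, exists2 a, A a & lclose k x a.
Proof.
split=> [xA k|xA W xW].
  by have [a [Aa xa]] := xA _ (lclose_nbhs x k); exists a.
have /choice[s sP] k : exists a, A a /\ lclose k x a by have [a] := xA k; exists a.
have [|k Wk] := nbhs_local_sum (s := s) xW; first by move=> k; case: (sP k).
by exists (s k); split=> //; case: (sP k).
Qed.

(** * p-adic powers of principal local units *)

Lemma Zp_exp_approx (a : padicInt p) u n P : U u ->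
  vnorm (Zp_exp u a P - u P ^+ a n) <= (q P ^+ m)^-1 * q P ^+ n.
Proof. by move=> Uu; apply: (vexp_approx (LP P)); exact: local_units_principal. Qed.

Lemma Zp_exp_lclose (a : padicInt p) u n : U u -> lclose n (Zp_exp u a) (u ^+ a (m + n)%N).
Proof.
move=> Uu P; rewrite lsX; apply: le_trans (Zp_exp_approx a _ P Uu) _.
by rewrite exprD mulKf// gt_eqF.
Qed.

Lemma Zp_exp_local_units (a : padicInt p) u : U u -> U (Zp_exp u a).
Proof.
move=> Uu; apply/local_unitsP => P.
rewrite /principal -(subrKA (u P ^+ a (m + 1)%N)); apply: vnormD_lt.
  have := Zp_exp_lclose a 1 Uu P; rewrite lsX expr1 => /le_lt_trans; exact.
by apply: principalX; exact: local_units_principal.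
Qed.

Lemma local_log_Zp_exp (a : padicInt p) u : U u ->
  local_log Kp (Zp_exp u a) = Zp_scale a (local_log Kp u).
Proof.
move=> Uu; apply/eqP; rewrite -subr_eq0; apply/eqP/log_lattice_sep => k.
apply: (pmul_le subgroup_log_lattice (leqnSn k)).
rewrite -(subrKA (local_log Kp u *+ a (m + k.+1)%N)) -[X in _ + X]opprB.
apply: (subgroupB (subgroup_pmul p subgroup_log_lattice k.+1)).
  rewrite -local_logX//; apply: local_log_lclose; first exact: Zp_exp_local_units.
    exact: local_unitsX.
  exact: Zp_exp_lclose.
apply: (pmul_le subgroup_log_lattice (leq_addl m k.+1)).
by apply: Zp_scaleP; exact: local_log_lattice.
Qed.

Lemma local_units_prod r (u : 'I_r -> V) : (forall i, U (u i)) -> U (\prod_i u i).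
Proof. by move=> Uu; apply: (big_ind U) => //; [exact: local_units1|exact: local_unitsM]. Qed.

Lemma local_log_prod r (u : 'I_r -> V) : (forall i, U (u i)) ->
  local_log Kp (\prod_i u i) = \sum_i local_log Kp (u i).
Proof.
move=> Uu; pose G x y := U x /\ local_log Kp x = y.
suff [] : G (\prod_i u i) (\sum_i local_log Kp (u i)) by [].
apply: (big_ind2 G) => [|x1 x2 y1 y2 [Ux xE] [Uy yE]|i _]; last by split.
  by split; [exact: local_units1|exact: local_log1].
by split; [exact: local_unitsM|rewrite local_logM// xE yE].
Qed.

Lemma lclose_prod k r (u v : 'I_r -> V) : (forall i, U (u i)) -> (forall i, U (v i)) ->
  (forall i, lclose k (u i) (v i)) -> lclose k (\prod_i u i) (\prod_i v i).
Proof.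
move=> Uu Uv uv; pose G x y := [/\ U x, U y & lclose k x y].
suff [] : G (\prod_i u i) (\prod_i v i) by [].
apply: (big_ind2 G) => [|x1 x2 y1 y2 [Ux1 Ux2 x12] [Uy1 Uy2 y12]|i _]; last by split.
  by split=> [||P]; rewrite ?subrr ?vnorm0 ?(ltW (qX_gt0 _ _))//; exact: local_units1.
split=> [||P]; [exact: local_unitsM|exact: local_unitsM|].
have -> : (x1 * y1) P - (x2 * y2) P = (x1 P - x2 P) * y1 P + x2 P * (y1 P - y2 P).
  by rewrite !lsM; ring.
apply: vnormD_le; rewrite vnormM (principal_norm (local_units_principal P _))// ?mulr1 ?mul1r.
  exact: x12.
exact: y12.
Qed.

Lemma vnorm_exp_sub (L : valuedField R) (x y : L) n :
  vnorm x <= 1 -> vnorm y <= 1 -> vnorm (x ^+ n - y ^+ n) <= vnorm (x - y).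
Proof.
move=> x1 y1; rewrite subrXX vnormM ler_piMr ?vnorm_ge0//.
by apply: vnorm_sum_le => // i _; rewrite vnormM !vnormX mulr_ile1 ?exprn_ge0 ?exprn_ile1 ?vnorm_ge0.
Qed.

Lemma padic_muln (a : padicInt p) N : exists b : padicInt p, forall n, b n = (N * a n %% p ^ n)%N.
Proof.
have lt n : (N * a n %% p ^ n < p ^ n)%N by rewrite ltn_pmod// expn_gt0 prime_gt0.
have co n : (N * a n.+1 %% p ^ n.+1 = N * a n %% p ^ n %[mod p ^ n])%N.
  by rewrite modn_mod modn_dvdm ?dvdn_exp2l// -modnMmr residue_coherent modnMmr.
by exists (PadicInt lt co).
Qed.

Lemma Zp_exp_muln (a b : padicInt p) N u : U u ->
  (forall n, b n = (N * a n %% p ^ n)%N) -> Zp_exp u b = Zp_exp u a ^+ N.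
Proof.
move=> Uu bE; apply: local_sumP => P; rewrite lsX; apply/eqP; rewrite -subr_eq0; apply/eqP.
apply: (vnorm_eq0_geometric (LP P) (C := (q P ^+ m)^-1)) => n.
have up := local_units_principal P Uu.
rewrite -(subrKA (u P ^+ b n)); apply: vnormD_le; first exact: Zp_exp_approx.
rewrite -(subrKA (u P ^+ (N * a n))); apply: vnormD_le.
  rewrite [in X in _ - X](divn_eq (N * a n) (p ^ n)) -bE addnC exprD -{1}[_ ^+ b n]mulr1 -mulrBr.
  rewrite vnormM vnormX (principal_norm up) expr1n mul1r vnormBC mulnC exprM.
  apply: (@le_trans _ _ (q P ^+ (n - m))).
    apply: vnorm_exp_sub1; last exact: (vnorm_expp_weak (LP P)).
    by rewrite (principal_norm (principalX _ up)).
  by rewrite ler_pdivlMl// -exprD ler_wiXn2l//; lia.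
rewrite mulnC exprM vnormBC; apply: le_trans (Zp_exp_approx a n P Uu).
apply: vnorm_exp_sub; last by rewrite vnormX (principal_norm up) expr1n.
by rewrite (principal_norm (local_units_principal P (Zp_exp_local_units a Uu))).
Qed.

(** A relation between the logarithms puts the product of powers in the kernel of the logarithm,
    which p^(m+1) kills. Multiplying the exponents by p^(m+1) gives a true multiplicative relation,
    and p^(m+1) g = 0 forces g = 0. *)
Lemma Zp_indep_log r (u : 'I_r -> V) : (forall i, U (u i)) -> Zp_indep u ->
  forall g, \sum_i Zp_scale (g i) (local_log Kp (u i)) = 0 -> forall i, padic_eq0 (g i).
Proof.
move=> Uu u_indep g g0.
have /choice[h hE] i := padic_muln (g i) (p ^ m.+1).
have Ug i : U (Zp_exp (u i) (g i)) by exact: Zp_exp_local_units.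
have /u_indep h0 : \prod_i Zp_exp (u i) (h i) = 1.
  have log0 : local_log Kp (\prod_i Zp_exp (u i) (g i)) = 0.
    by rewrite local_log_prod// -[RHS]g0; apply: eq_bigr => i _; exact: local_log_Zp_exp.
  rewrite -[RHS](local_log_ker (local_units_prod Ug) log0) -prodrXl.
  apply: eq_bigr => i _; exact: Zp_exp_muln.
move=> i k; have := h0 i (m.+1 + k)%N; rewrite hE => /eqP; rewrite -/(dvdn _ _).
rewrite expnD dvdn_pmul2l ?expn_gt0 ?prime_gt0// => /eqP gk.
have := padic_residue_mod (g i) (leq_addl m.+1 k); rewrite gk.
by rewrite [RHS]modn_small ?residue_lt.
Qed.

(** * Global units and the lattice of their logarithms *)

Lemma diag_local_units e : E e -> U (diag Kp e).
Proof.
move=> Ee; apply/local_unitsP => P.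
have [x Px ex] := principal_units_prime pp Ee (set_valP P).
rewrite /principal /diag -(rmorph1 (completion_map (Kp P))) -rmorphB ex.
exact: completion_principal.
Qed.

Lemma diagM e f : diag Kp (e * f) = diag Kp e * diag Kp f.
Proof. by apply: local_sumP => P; exact: rmorphM. Qed.

Lemma diag1 : diag Kp 1 = 1.
Proof. by apply: local_sumP => P; exact: rmorph1. Qed.

Lemma diagX e n : diag Kp (e ^+ n) = diag Kp e ^+ n.
Proof. by elim: n => [|n IH]; rewrite ?diag1// !exprS diagM IH. Qed.

Lemma diag_inj : injective (diag Kp).
Proof.
move=> e f ef; have [P Pp] := primes_above_neq0 K pp.
have := congr1 (fun x : V => x (SigSub (mem_set Pp))) ef.
exact: fmorph_inj.
Qed.

Definition unit_log (e : K) : V := local_log Kp (diag Kp e).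

Lemma unit_logM e f : E e -> E f -> unit_log (e * f) = unit_log e + unit_log f.
Proof. by move=> Ee Ef; rewrite /unit_log diagM local_logM//; exact: diag_local_units. Qed.

Lemma unit_log1 : unit_log 1 = 0.
Proof. by rewrite /unit_log diag1 local_log1. Qed.

Lemma unit_logV e : E e -> unit_log e^-1 = - unit_log e.
Proof.
move=> Ee; apply/eqP; rewrite -addr_eq0 -unit_logM//; last exact: principal_unitsV.
by rewrite mulVf ?unit_log1// (principal_units_neq0 Ee).
Qed.

Lemma unit_logX e n : E e -> unit_log (e ^+ n) = unit_log e *+ n.
Proof. by move=> Ee; rewrite /unit_log diagX local_logX//; exact: diag_local_units. Qed.

Lemma principal_unitsXz e (a : int) : E e -> E (e ^ a).
Proof.
by move=> Ee; case: a => n; [|rewrite NegzE -exprnN; apply: principal_unitsV => //]; exact: principal_unitsX.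
Qed.

Lemma unit_logXz e (a : int) : E e -> unit_log (e ^ a) = unit_log e *~ a.
Proof.
move=> Ee; case: a => n; first exact: unit_logX.
rewrite NegzE -exprnN unit_logV ?unit_logX ?mulrNz//; exact: principal_unitsX.
Qed.

Lemma unit_log_prodXz r (e : 'I_r -> K) (a : 'I_r -> int) : (forall i, E (e i)) ->
  unit_log (\prod_i e i ^ a i) = \sum_i unit_log (e i) *~ a i.
Proof.
move=> Ee; pose G (x : K) (y : V) := E x /\ unit_log x = y.
suff [] : G (\prod_i e i ^ a i) (\sum_i unit_log (e i) *~ a i) by [].
apply: (big_ind2 G) => [|x1 x2 y1 y2 [Ex xE] [Ey yE]|i _].
- by split; [exact: principal_units1|exact: unit_log1].
- by split; [exact: principal_unitsM|rewrite unit_logM// xE yE].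
- by split; [exact: principal_unitsXz|exact: unit_logXz].
Qed.

Definition log_units : set V := local_log Kp @` (diag Kp @` E).

Lemma log_unitsP x : log_units x <-> exists2 e, E e & unit_log e = x.
Proof.
split=> [[_ [e Ee <-] <-]|[e Ee <-]]; first by exists e.
by exists (diag Kp e) => //; exists e.
Qed.

Lemma subgroup_log_units : subgroup log_units.
Proof.
split; first by apply/log_unitsP; exists 1; [exact: principal_units1|exact: unit_log1].
move=> _ _ /log_unitsP[e Ee <-] /log_unitsP[f Ef <-]; apply/log_unitsP.
exists (e * f^-1); first by apply: principal_unitsM => //; exact: principal_unitsV.
by rewrite unit_logM ?unit_logV//; exact: principal_unitsV.
Qed.

Lemma log_units_lattice : log_units `<=` B.
Proof. by move=> _ /log_unitsP[e Ee <-]; apply: local_log_lattice; exact: diag_local_units. Qed.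

Local Notation Lambda := (adic_closure p B log_units).

Let subLambda : subgroup Lambda.
Proof. exact: (subgroup_adic_closure p subgroup_log_lattice subgroup_log_units). Qed.

Lemma unit_closureP u : unit_closure Kp u <->
  U u /\ forall k, exists2 e, E e & lclose k u (diag Kp e).
Proof.
split=> [[Uu uE]|[Uu uE]]; split=> //.
  by move=> k; have /closureP/(_ k)[_ [e Ee <-] ue] := uE; exists e.
by apply/closureP => k; have [e Ee ue] := uE k; exists (diag Kp e) => //; exists e.
Qed.

Lemma unit_closure_subset : local_log Kp @` unit_closure Kp `<=` Lambda.
Proof.
move=> _ [u /unit_closureP[Uu uE] <-] k; have [e Ee ue] := uE k.+1.
exists (unit_log e); first by apply/log_unitsP; exists e.
apply: (pmul_le subgroup_log_lattice (leqnSn k)).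
by apply: local_log_lclose => //; exact: diag_local_units.
Qed.

Section Generators.
Context (t : nat) (l : 'I_t -> V).
Hypothesis Ll : forall i, log_units (l i).
Hypothesis lL : forall x, log_units x ->
  exists c, exists2 y, log_units y & x = \sum_i l i *~ c i + y *+ p.

Let padic_span := adic_closure_padic_span pp local_sum_tf subgroup_log_lattice
  subgroup_log_units log_units_lattice Ll lL log_lattice_sep Zp_scaleP.

(** One inclusion is continuity of the logarithm. Conversely a p-adic combination of the l_i = log
    e_i is the logarithm of the product of the p-adic powers of the e_i, approximated by global
    units through the residues of the exponents. *)
Lemma unit_closure_log : local_log Kp @` unit_closure Kp = Lambda.
Proof.
apply/seteqP; split; first exact: unit_closure_subset.
move=> x /padic_span[g ->].
have /choice[e eP] i : exists e, E e /\ unit_log e = l i.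
  by have /log_unitsP[e Ee <-] := Ll i; exists e.
have Ee i : E (e i) by case: (eP i).
have Ue i : U (diag Kp (e i)) by exact: diag_local_units.
exists (\prod_i Zp_exp (diag Kp (e i)) (g i)).
  apply/unit_closureP; split; first by apply: local_units_prod => i; exact: Zp_exp_local_units.
  move=> k; exists (\prod_i e i ^+ g i (m + k)%N).
    by apply: (big_ind E) => [||i _]; [exact: principal_units1|exact: principal_unitsM|exact: principal_unitsX].
  have -> : diag Kp (\prod_i e i ^+ g i (m + k)%N) = \prod_i diag Kp (e i) ^+ g i (m + k)%N.
    by rewrite (big_morph _ diagM diag1); apply: eq_bigr => i _; exact: diagX.
  apply: lclose_prod => i; [exact: Zp_exp_local_units|exact: local_unitsX|exact: Zp_exp_lclose].
rewrite local_log_prod => [|i]; last exact: Zp_exp_local_units.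
by apply: eq_bigr => i _; rewrite local_log_Zp_exp// -(eP i).2.
Qed.

Lemma unit_closure_span :
  local_log Kp @` unit_closure Kp = Zp_span (local_log Kp @` (diag Kp @` E)).
Proof.
rewrite unit_closure_log; apply/seteqP; split=> [x /padic_span[g ->]|_ [n [a [y [yL ->]]]]].
  by exists t, g, l.
apply: (subgroup_sum subLambda) => i.
apply: (adic_closure_sc subgroup_log_lattice subgroup_log_units log_units_lattice Zp_scaleP).
exact/(sub_adic_closure p subgroup_log_lattice)/yL.
Qed.

End Generators.

Lemma leopoldt_lattice : leopoldt Kp -> exists t (l : 'I_t -> V) d,
  [/\ forall i, log_units (l i),
      forall x, log_units x ->
        exists c, exists2 y, log_units y & x = \sum_i l i *~ c i + y *+ p &
      adic_indep p B l d].
Proof.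
move=> [r [[u uE u_indep] _] [_ Er]].
have [s x Lx x_indep|t [l [tr Ll lL]]] :=
    @mod_p_basis V p pp local_sum_tf log_units r subgroup_log_units.
  have /choice[e eP] i : exists e, E e /\ unit_log e = x i.
    by have /log_unitsP[e Ee <-] := Lx i; exists e.
  have Ee i : E (e i) by case: (eP i).
  (* A multiplicative relation between units gives a linear one between their logarithms, so the
     Z-rank of the logarithms is at most r. *)
  apply: (Er s e Ee) => a ea; apply: x_indep.
  have := unit_log_prodXz a Ee; rewrite ea unit_log1 => a0; rewrite [RHS]a0.
  by apply: eq_bigr => i _; rewrite (eP i).2.
have Uu i : U (u i) by case: (uE i).
(* The Leopoldt hypothesis enters here: the closure has r independent elements for the same r that
   bounds the number of generators. *)
have [d ud] := adic_indep_of_padic pp subgroup_log_lattice log_lattice_sep Zp_scaleP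
  (fun i => local_log_lattice (Uu i)) (Zp_indep_log Uu u_indep).
exists t, l, d; split=> //.
apply: (adic_indep_transfer pp local_sum_tf subgroup_log_lattice subgroup_log_units
  log_units_lattice Ll lL tr _ ud) => j.
by apply: unit_closure_subset; exists (u j).
Qed.

(** * The Kummer--Leopoldt constant and the torsion exponent *)

Section Exponent.
Context (t : nat) (l : 'I_t -> V) (d : nat).
Hypothesis Ll : forall i, log_units (l i).
Hypothesis lL : forall x, log_units x ->
  exists c, exists2 y, log_units y & x = \sum_i l i *~ c i + y *+ p.
Hypothesis ld : adic_indep p B l d.

Local Notation logU := (local_log Kp @` U).

Lemma log_torsionP x : torsion_mod logU Lambda x <->
  exists2 u, U u & x = local_log Kp u /\ exists k, Lambda (x *+ p ^ k).
Proof.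
split=> [[[u Uu <-] [a a0 aL]]|[u Uu [-> [k kL]]]].
  exists u => //; split=> //.
  exact: (padic_torsion pp subgroup_log_lattice subgroup_log_units Zp_scaleP
    (local_log_lattice Uu) a0 aL).
split; first by exists u.
(* The annihilating p-adic integer is p^k itself, given by its residues. *)
have lt n : (p ^ k %% p ^ n < p ^ n)%N by rewrite ltn_pmod// expn_gt0 prime_gt0.
have co n : (p ^ k %% p ^ n.+1 = p ^ k %% p ^ n %[mod p ^ n])%N.
  by rewrite modn_mod modn_dvdm// dvdn_exp2l.
exists (PadicInt lt co).
  move=> /(_ k.+1) /=; rewrite modn_small ?ltn_exp2l ?prime_gt1//.
  by move=> /eqP; rewrite expn_eq0 eqn0Ngt prime_gt0.
suff -> : Zp_scale (PadicInt lt co) (local_log Kp u) = local_log Kp u *+ p ^ k by [].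
apply/eqP; rewrite -subr_eq0; apply/eqP/log_lattice_sep => n.
apply: (pmul_le subgroup_log_lattice (leq_addl k.+1 n)).
have := Zp_scaleP (PadicInt lt co) (local_log_lattice Uu) (k.+1 + n)%N.
by rewrite /= modn_small// ltn_exp2l ?prime_gt1// addSn ltnS leq_addr.
Qed.

Definition log_torsion_killed N := forall x, torsion_mod logU Lambda x -> Lambda (x *+ N).

Lemma log_torsion_bounded : log_torsion_killed (p ^ d).
Proof.
move=> x /log_torsionP[u Uu [-> [k kL]]].
apply: (lattice_torsion_bound pp local_sum_tf subgroup_log_lattice subgroup_log_units
  log_units_lattice Ll lL ld _ kL).
exact: local_log_lattice.
Qed.

Lemma log_torsion_finite : finite_set (quotient_torsion logU Lambda).
Proof.
exact: (lattice_torsion_finite pp local_sum_tf subgroup_log_lattice subgroup_log_units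
  Ll lL log_torsion_bounded).
Qed.

Lemma kummer_leopoldt_of_killed c :
  log_torsion_killed (p ^ c) -> kummer_leopoldt_bound Kp c.
Proof.
(* From m + 1 on, p^n kills the kernel of the logarithm. *)
move=> killed; exists m.+1 => n mn e Ee [u Uu ue].
have ex : unit_log e = local_log Kp u *+ p ^ c *+ p ^ n.
  by rewrite /unit_log -ue local_logX// -mulrnA -expnD addnC.
have [z /log_unitsP[f Ef <-] fE] : exists2 z, log_units z & unit_log e = z *+ p ^ n.
  apply: (lattice_saturated pp local_sum_tf subgroup_log_lattice subgroup_log_units
    log_units_lattice Ll lL ld _ _ ex); last by apply/log_unitsP; exists e.
  apply: killed; apply/log_torsionP; exists u => //; split=> //; exists (n + c)%N.
  rewrite -local_logX// ue; apply: sub_adic_closure; first exact: subgroup_log_lattice.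
  by apply/log_unitsP; exists e.
have fU : U (diag Kp f) by exact: diag_local_units.
have uf : local_log Kp (u ^+ (p ^ c)) = local_log Kp (diag Kp f).
  by rewrite local_logX//; apply: (mulrnX_inj local_sum_tf (k := n)); rewrite -ex fE.
have := local_log_inj (local_unitsX (p ^ c) Uu) fU uf.
move=> /(congr1 (fun x => x ^+ (p ^ (n - m.+1)))); rewrite -!exprM -!expnD subnKC//.
rewrite addnC ue -diagX => /diag_inj ef.
by exists f.
Qed.

Lemma killed_of_kummer_leopoldt c :
  kummer_leopoldt_bound Kp c -> log_torsion_killed (p ^ c).
Proof.
move=> [N NP] x /log_torsionP[u Uu [-> [k kL]]]; set x' := local_log Kp u in kL *.
(* Large enough for the bound to apply and for p^(n+c) times [x'] to lie in Lambda. *)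
pose n := (N + k)%N.
have nL : Lambda (x' *+ p ^ (n + c)).
  rewrite /n -addnA addnCA expnD mulrnA; exact: (subgroupMn subLambda).
have [a [b [/log_unitsP[e Ee <-] bL ebE]]] := closure_lattice_generators pp local_sum_tf
  subgroup_log_lattice subgroup_log_units Ll lL (n + c) nL.
(* With b = log v, the unit e has the same logarithm as the p^(n+c)-th power of u/v. *)
have [v /unit_closureP[Uv _] vb] : (local_log Kp @` unit_closure Kp) b.
  by rewrite (unit_closure_log Ll lL).
have [w Uw vw] := local_units_inv Uv.
have wb : local_log Kp w = - b.
  by apply/eqP; rewrite -addr_eq0 -vb -local_logM// mulrC vw local_log1.
have Uuw : U (u * w) by exact: local_unitsM.
have eu : local_log Kp (diag Kp e) = local_log Kp ((u * w) ^+ (p ^ (n + c))).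
  rewrite local_logX// local_logM// wb mulrnBl -/x' ebE addrK.
  by [].
have := local_log_inj (diag_local_units Ee) (local_unitsX _ Uuw) eu.
rewrite -diagX -exprM -expnD addnAC => euE.
(* Raising to the power p^(m+1) removes the kernel of the logarithm, so the bound is used at level n
   + m + 1; the extra factor is cancelled after taking logarithms. *)
have [f Ef fe] : powers (principal_units K p) (p ^ (n + m.+1)) (e ^+ (p ^ m.+1)).
  apply: NP.
  - by rewrite /n -addnA leq_addr.
  - exact: principal_unitsX.
  - by exists (u * w).
have ef : unit_log e = unit_log f *+ p ^ n.
  apply: (mulrnX_inj local_sum_tf (k := m.+1)); rewrite -(unit_logX _ Ee) -fe.
  by rewrite (unit_logX _ Ef) expnD mulrnA.
have -> : x' *+ p ^ c = unit_log f + b *+ p ^ c.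
  apply: (mulrnX_inj local_sum_tf (k := n)).
  by rewrite mulrnDl -!mulrnA -!expnD ![(c + n)%N]addnC ebE ef.
apply: (subgroupD subLambda); last exact: (subgroupMn subLambda).
apply: sub_adic_closure; first exact: subgroup_log_lattice.
by apply/log_unitsP; exists f.
Qed.

(** The two preceding implications identify the Kummer--Leopoldt bounds with the c for which p^c
    kills the torsion; kappa is the least such c. *)
Lemma kummer_leopoldt_exponent : exists kappa,
  is_kummer_leopoldt_constant Kp kappa /\ is_torsion_exponent logU Lambda (p ^ kappa).
Proof.
have ex : exists c, `[< log_torsion_killed (p ^ c) >].
  by exists d; apply/asboolP; exact: log_torsion_bounded.
case: (ex_minnP ex) => kappa /asboolP killed kmin; exists kappa; split.
  split; first exact: kummer_leopoldt_of_killed.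
  by move=> c /killed_of_kummer_leopoldt cK; apply: kmin; apply/asboolP.
split=> //; first by rewrite expn_gt0 prime_gt0.
move=> N N0 NK.
(* Any N killing the torsion may be replaced by its gcd with p^d, a power of p that also kills it by
   Bezout. *)
have [j jd jE] : exists2 j, (j <= d)%N & gcdn N (p ^ d) = (p ^ j)%N.
  by apply/dvdn_pfactor => //; exact: dvdn_gcdr.
have jN : (p ^ j <= N)%N by rewrite -jE dvdn_leq// dvdn_gcdl.
apply: leq_trans jN; rewrite leq_exp2l ?prime_gt1//; apply: kmin; apply/asboolP => x xT.
have [a b ab _] := egcdnP (p ^ d) N0.
have -> : x *+ p ^ j = x *+ N *+ a - x *+ p ^ d *+ b.
  by rewrite -!mulrnA -jE [(N * a)%N]mulnC ab mulrnDr [(p ^ d * b)%N]mulnC addrC addKr.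
apply: (subgroupB subLambda); apply: (subgroupMn subLambda); first exact: NK.
exact: log_torsion_bounded.
Qed.

End Exponent.

End LocalSumTheory.

Theorem theorem2p1 (R : realType) (K : fieldExtType rat) (p : nat)
    (Kp : forall P : primes_above K p, adicCompletion R (val P)) :
  prime p -> leopoldt Kp ->
  let logU := local_log Kp @` local_units Kp in
  let logE := local_log Kp @` unit_closure Kp in
  logE = Zp_span (local_log Kp @` (diag Kp @` principal_units K p)) /\
  exists kappa : nat,
    [/\ is_kummer_leopoldt_constant Kp kappa,
        finite_set (quotient_torsion logU logE) &
        is_torsion_exponent logU logE (p ^ kappa)].
Proof.
move=> pp /(leopoldt_lattice pp)[t [l [d [Ll lL ld]]]] logU logE.
split; first exact: (unit_closure_span pp Ll lL).
rewrite /logE (unit_closure_log pp Ll lL).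
have [kappa [KL expo]] := kummer_leopoldt_exponent pp Ll lL ld.
by exists kappa; split=> //; exact: (log_torsion_finite pp Ll lL ld).
Qed.
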